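(* Suppose Assumptions 1–5 of the context hold (the $f_{i,t}$ need not be convex), and $\{x_{i,t}\}$ is generated by the ODCSGD algorithm of the context with $\lambda_t=2B_gt^{\alpha}$ and $\eta_t=\frac{1}{(at+b)^{\kappa}}$, where $\kappa=\frac{p+1}{2p}$ and $\alpha=\frac{1}{2p}$. Then for any $\delta\in(0,1)$, with probability at least $1-\delta$, $$\boldsymbol{NREG}_T^d=\mathcal O\!\left(T^{\frac{1+p}{2p}}\Big(1+D_T+\log\frac1\delta\Big)\right),$$ i.e. there is a constant $K$ independent of $T$ and $\delta$ such that, for every $T\ge1$ and every $\delta\in(0,1)$, with probability at least $1-\delta$, $\boldsymbol{NREG}_T^d\le K\,T^{\frac{1+p}{2p}}\big(1+D_T+\log\frac1\delta\big)$.
   Context: Setting: $N$ agents $\mathcal V=[N]=\{1,\dots,N\}$, horizon $T\in\mathbb N$, differentiable, not necessarily convex costs $f_{i,t}:\mathbb R^d\to\mathbb R$ (defined also for $t=T+1$), $f_t=\sum_{i=1}^N f_{i,t}$. $\|\cdot\|$ is the 2-norm. Function variation: $D_T=\sum_{t=2}^T\|f_t-f_{t-1}\|_{\sup}$ with $\|f_t-f_{t-1}\|_{\sup}=\sup_{x\in\mathbb R^d}|f_t(x)-f_{t-1}(x)|$. Dynamic regret for the non-convex case: $\boldsymbol{NREG}_T^d=\sum_{t=1}^T\sum_{i=1}^N\|\nabla f_t(x_{i,t})\|^2$. Algorithm (ODCSGD): from initial states $x_{i,1}\in\mathbb R^d$, $y_{i,t}=\sum_{j=1}^N[W_t]_{ij}x_{j,t}$,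 $\ \widetilde\nabla f_{i,t}(x_{i,t})=\mathrm{clip}_{\lambda_t}(\widehat\nabla f_{i,t}(x_{i,t}))$, $\ x_{i,t+1}=y_{i,t}-\eta_t\widetilde\nabla f_{i,t}(x_{i,t})$, where $\mathrm{clip}_{\lambda}(y)=\min\{1,\lambda/\|y\|\}\,y$ (and $\mathrm{clip}_\lambda(0)=0$), $\widehat\nabla f_{i,t}$ is a random (noisy) gradient, $\lambda_t>0$ are clipping levels, and $\{\eta_t\}$ is a positive non-increasing step size sequence; in $\eta_t=(at+b)^{-\kappa}$, $a>0$ and $b\ge0$ are constants. $\bar x_t=\frac1N\sum_{i=1}^N x_{i,t}$. $\mathcal F_t$ denotes the $\sigma$-field generated by the gradient estimators of rounds $1,\dots,t-1$; $x_{i,t}$ is $\mathcal F_t$-measurable. Assumption 1: $\mathbb E[\widehat\nabla f_{i,t}(x)\mid x]=\nabla f_{i,t}(x)$ for all $x\in\mathbb R^d$ and all $i$. Assumption 2 (heavy-tailed noise): $\mathbb E[\|\widehat\nabla f_{i,t}(x)-\nabla f_{i,t}(x)\|^p\mid x]\le\sigma^p$ for all $x$ and all $i$, for some $\sigma>0$ and $p\in(1,2]$. In Assumptions 1–2, at the query point $x=x_{i,t}$ of round $t$ conditioning is understood as conditioning on $\mathcal F_t$. Assumption 3: each $f_{i,t}$ is $L$-smooth: $\|\nabla f_{i,t}(x)-\nabla f_{i,t}(y)\|\le L\|x-y\|$ for all $x,y$ (hence $f_{i,t}(y)\le f_{i,t}(x)+\langle\nabla f_{i,t}(x),y-x\rangle+\frac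 L2\|y-x\|^2$). Assumption 4: there are $B_X>0$, $B_g>0$ such that almost surely, for all $i,t$, $\|x_{i,t}\|\le B_X$, $\|\nabla f_{i,t}(x_{i,t})\|\le B_g$ and $\|\nabla f_{i,t}(\bar x_t)\|\le B_g$. Assumption 5: the directed graphs $\mathcal G_t=(\mathcal V,W_t,\mathcal E_t)$, $t\ge1$, with $\mathcal N_{i,t}=\{j:(i,j)\in\mathcal E_t\}\cup\{i\}$, satisfy: (a) there is $\eta\in(0,1)$ with $[W_t]_{ij}\ge\eta$ if $j\in\mathcal N_{i,t}$ and $[W_t]_{ij}=0$ otherwise; (b) $W_t$ is doubly stochastic; (c) there is an integer $B>0$ such that $(\mathcal V,\bigcup_{l=0}^{B-1}\mathcal E_{t+l})$ is strongly connected for every $t\ge1$. The constants $N,\sigma,p,L,B_X,B_g,\eta,B,a,b$ do not depend on $T$ or $\delta$. *)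

(* Defs.v *)
From HB Require Import structures.
From mathcomp Require Import all_boot all_order all_algebra.
From mathcomp Require Import all_classical all_reals all_analysis.

Set Implicit Arguments.
Unset Strict Implicit.
Unset Printing Implicit Defensive.

Import Order.TTheory GRing.Theory Num.Theory.
Import numFieldNormedType.Exports.

Local Open Scope classical_set_scope.
Local Open Scope ring_scope.

(* The canonical norm of 'rV[R]_d is the sup norm; the 2-norm is needed here.
   Both induce the same topology, hence the same notion of differentiability. *)
Definition enorm (R : realType) (d : nat) (x : 'rV[R]_d) : R :=
  Num.sqrt (\sum_(k < d) (x 0 k) ^+ 2).

Definition grad (R : realType) (d : nat) (f : 'rV[R]_d -> R) (x : 'rV[R]_d) :
    'rV[R]_d :=
  \row_(k < d) ('d f x (delta_mx 0 k : 'rV[R]_d)).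

(* Since 0^-1 = 0, clip lam 0 = 0. *)
Definition clip (R : realType) (d : nat) (lam : R) (y : 'rV[R]_d) : 'rV[R]_d :=
  Num.min 1 (lam / enorm y) *: y.

(* Y is a version of the conditional expectation E[X | <<s G>>]. *)
Definition is_cond_exp (R : realType) (dsp : measure_display)
    (Omega : measurableType dsp) (P : probability Omega R)
    (G : set (set Omega)) (X Y : Omega -> R) : Prop :=
  [/\ P.-integrable setT (EFin \o X),
      P.-integrable setT (EFin \o Y),
      measurable_fun setT (Y : g_sigma_algebraType G -> R) &
      forall A : set Omega, <<s G >> A ->
        (\int[P]_(w in A) (X w)%:E = \int[P]_(w in A) (Y w)%:E)%E].

(* Times are 1-based: rounds are 1, ..., T.  Costs are indexed as f i t. *)
Section Costs.
Variables (R : realType) (d N : nat).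
Implicit Types (f : 'I_N -> nat -> 'rV[R]_d -> R) (x : 'I_N -> nat -> 'rV[R]_d).

Definition total_cost f (t : nat) (y : 'rV[R]_d) : R := \sum_(i < N) f i t y.

(* Extended-real valued, as the suprema may be infinite. *)
Definition function_variation f (T : nat) : \bar R :=
  (\sum_(2 <= t < T.+1)
     ereal_sup [set (`|total_cost f t y - total_cost f t.-1 y|)%:E
               | y in [set: 'rV[R]_d]])%E.

Definition nreg f x (T : nat) : R :=
  \sum_(1 <= t < T.+1) \sum_(i < N) enorm (grad (total_cost f t) (x i t)) ^+ 2.

Definition mean_state x (t : nat) : 'rV[R]_d := N%:R^-1 *: \sum_(i < N) x i t.

Definition smooth_costs (L : R) (T : nat) f : Prop :=
  forall (i : 'I_N) (t : nat), (1 <= t <= T.+1)%N ->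
    (forall y : 'rV[R]_d, differentiable (f i t) y) /\
    (forall y z : 'rV[R]_d,
       enorm (grad (f i t) y - grad (f i t) z) <= L * enorm (y - z)).

End Costs.

(* E t i j means that (i, j) is an edge of the round-t graph. *)
Section Graphs.
Variables (R : realType) (N : nat).
Implicit Types (W : nat -> 'M[R]_N) (E : nat -> rel 'I_N).

Definition in_nbh E (t : nat) (i j : 'I_N) : bool := E t i j || (j == i).

Definition weights_compatible (eta : R) W E : Prop :=
  forall (t : nat) (i j : 'I_N), (1 <= t)%N ->
    (in_nbh E t i j -> eta <= W t i j) /\
    (~~ in_nbh E t i j -> W t i j = 0).

Definition doubly_stochastic W : Prop :=
  forall t : nat, (1 <= t)%N ->
    [/\ forall i j, 0 <= W t i j,
        forall i, \sum_(j < N) W t i j = 1 &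
        forall j, \sum_(i < N) W t i j = 1].

Definition jointly_strongly_connected (B : nat) E : Prop :=
  forall t : nat, (1 <= t)%N ->
    forall i j : 'I_N,
      connect [rel u v | [exists l : 'I_B, E (t + l)%N u v]] i j.

Definition network_assumption (eta : R) (B : nat) W E : Prop :=
  [/\ weights_compatible eta W E, doubly_stochastic W &
      jointly_strongly_connected B E].

End Graphs.

(* g i t x w is the value at x, for the outcome w, of the noisy gradient of
   f i t; x i t w is the state of agent i at round t. *)
Section Algorithm.
Variables (R : realType) (d N : nat).
Variables (dsp : measure_display) (Omega : measurableType dsp).
Variable P : probability Omega R.
Implicit Types (f : 'I_N -> nat -> 'rV[R]_d -> R)
  (g : 'I_N -> nat -> 'rV[R]_d -> Omega -> 'rV[R]_d)
  (x : 'I_N -> nat -> Omega -> 'rV[R]_d).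

Definition odcsgd (T : nat) (lam eta : nat -> R) (W : nat -> 'M[R]_N)
    (x1 : 'I_N -> 'rV[R]_d) g x : Prop :=
  (forall i w, x i 1%N w = x1 i) /\
  (forall i t w, (1 <= t <= T)%N ->
     x i t.+1 w = \sum_(j < N) W t i j *: x j t w
                  - eta t *: clip (lam t) (g i t (x i t w) w)).

(* Generators of the sigma-field F_t: the coordinates of the estimators
   actually computed at rounds 1, ..., t - 1. *)
Definition history g x (t : nat) : set (set Omega) :=
  [set A | exists (i : 'I_N) (s : nat) (k : 'I_d) (U : set R),
     [/\ (1 <= s < t)%N, measurable U &
         A = (fun w => g i s (x i s w) w 0 k) @^-1` U]].

(* First clause: deterministic query points; second clause: the query point of
   the round, conditionally on F_t. *)
Definition unbiased_gradients (T : nat) f g x : Prop :=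
  forall (i : 'I_N) (t : nat), (1 <= t <= T)%N ->
    (forall (y : 'rV[R]_d) (k : 'I_d),
       P.-integrable setT (EFin \o (fun w => g i t y w 0 k)) /\
       ('E_P[fun w => g i t y w 0%R k] = (grad (f i t) y 0%R k)%:E)%E) /\
    (forall k : 'I_d,
       is_cond_exp P (history g x t)
         (fun w => g i t (x i t w) w 0 k)
         (fun w => grad (f i t) (x i t w) 0 k)).

Definition heavy_tailed_noise (T : nat) (p sigma : R) f g x : Prop :=
  forall (i : 'I_N) (t : nat), (1 <= t <= T)%N ->
    (forall y : 'rV[R]_d,
       ('E_P[fun w => (enorm (g i t y w - grad (f i t) y) `^ p)%R]
        <= (sigma `^ p)%:E)%E) /\
    (exists2 Z : Omega -> R,
       is_cond_exp P (history g x t)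
         (fun w => enorm (g i t (x i t w) w - grad (f i t) (x i t w)) `^ p) Z &
       {ae P, forall w, Z w <= sigma `^ p}).

Definition bounded_iterates (T : nat) (BX Bg : R) f x : Prop :=
  {ae P, forall w, forall (i : 'I_N) (t : nat), (1 <= t <= T.+1)%N ->
     [/\ enorm (x i t w) <= BX,
         enorm (grad (f i t) (x i t w)) <= Bg &
         enorm (grad (f i t) (mean_state (fun j s => x j s w) t)) <= Bg]}.

End Algorithm.

(* Main.v *)
Require Import Defs.
From HB Require Import structures.
From mathcomp Require Import all_boot all_order all_algebra.
From mathcomp Require Import all_classical all_reals all_analysis.
From mathcomp Require Import measurable_realfun.
From mathcomp Require Import ring lra.

Set Implicit Arguments.
Unset Strict Implicit.
Unset Printing Implicit Defensive.

Import Order.TTheory GRing.Theory Num.Theory.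
Import numFieldNormedType.Exports.

Local Open Scope classical_set_scope.
Local Open Scope ring_scope.

(** Write h_t for the gradient of f_t at the mean state. Smoothness of f_t along
    one step of the mean state bounds (step_t / N) |h_t|^2 by the decrease of f_t,
    plus the deviation X_t caused by the clipped noise, plus consensus and
    quadratic errors. Decreases telescope up to 2 D_T.

    Consensus: over N B rounds the oscillation of the states contracts by a fixed
    factor up to the clipped steps, which are O(t^(-1/2)); weighted by
    step_t = O(t^(-kappa)) the oscillations are summable since kappa > 1/2.

    Noise: |X_t| is bounded, so e^X_t <= 1 + X_t + O(X_t^2), and with n_i the noise
    vectors, X_t is a martingale difference plus terms linear in |n_i|^p, because
    the clipping bias is at most |n_i|^p (2/lam)^(p-1) and the squared clipped
    error is O(|n_i|^p lam^(2-p)). Taking conditional expectations and applying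
    Young's inequality to the bias, exp (sum (X_t - (step_t / 2N) |h_t|^2)) is a
    supermartingale up to a summable deterministic drift. Markov's inequality then
    bounds the sum of the X_t by half the left-hand side plus O(1) + log (1/delta).
    Crude summation of the bias or of the squared steps would each lose a
    logarithm of T; Young's inequality and keeping the squared error inside the
    exponent avoid this. *)

(** * Euclidean norm and sums of powers *)

Section EuclideanNorm.
Variables (R : realType) (d : nat).
Implicit Types u v w : 'rV[R]_d.

Definition dot u v : R := \sum_(k < d) u 0 k * v 0 k.

Lemma dotC u v : dot u v = dot v u.
Proof. by apply: eq_bigr => k _; rewrite mulrC. Qed.

Lemma dotDr u v w : dot u (v + w) = dot u v + dot u w.
Proof. by rewrite -big_split; apply: eq_bigr => k _; rewrite mxE mulrDr. Qed.

Lemma dotZr c u v : dot u (c *: v) = c * dot u v.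
Proof. by rewrite big_distrr; apply: eq_bigr => k _; rewrite mxE mulrCA. Qed.

Lemma dotNr u v : dot u (- v) = - dot u v.
Proof. by rewrite -scaleN1r dotZr mulN1r. Qed.

Lemma dotBr u v w : dot u (v - w) = dot u v - dot u w.
Proof. by rewrite dotDr dotNr. Qed.

Lemma dotBl u v w : dot (u - v) w = dot u w - dot v w.
Proof. by rewrite dotC dotBr !(dotC w). Qed.

Lemma dot_sumr (I : Type) (r : seq I) u (F : I -> 'rV[R]_d) :
  dot u (\sum_(i <- r) F i) = \sum_(i <- r) dot u (F i).
Proof.
elim/big_rec2: _ => [|i y1 y2 _ <-]; last by rewrite dotDr.
by apply: big1 => k _; rewrite mxE mulr0.
Qed.

Lemma enorm_sqr u : enorm u ^+ 2 = dot u u.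
Proof.
rewrite /enorm sqr_sqrtr; first by apply: eq_bigr => k _; rewrite expr2.
by apply: sumr_ge0 => k _; rewrite sqr_ge0.
Qed.

Lemma enorm_ge0 u : 0 <= enorm u.
Proof. exact: sqrtr_ge0. Qed.

Lemma enormZ c u : enorm (c *: u) = `|c| * enorm u.
Proof.
rewrite /enorm -sqrtr_sqr -sqrtrM ?sqr_ge0// big_distrr; congr Num.sqrt.
by apply: eq_bigr => k _; rewrite mxE exprMn.
Qed.

Lemma enormN u : enorm (- u) = enorm u.
Proof. by rewrite -scaleN1r enormZ normrN1 mul1r. Qed.

Lemma enormB u v : enorm (u - v) = enorm (v - u).
Proof. by rewrite -enormN opprB. Qed.

Lemma enorm0 : enorm (0 : 'rV[R]_d) = 0.
Proof. by rewrite -(scale0r 0) enormZ normr0 mul0r. Qed.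

Lemma enorm_eq0 u : enorm u = 0 -> u = 0.
Proof.
move=> u0; have /eqP : enorm u ^+ 2 = 0 by rewrite u0 expr0n.
rewrite enorm_sqr psumr_eq0 => [/allP h|k _]; last by rewrite -expr2 sqr_ge0.
apply/rowP => k; rewrite mxE; apply/eqP.
by have := h k (mem_index_enum k); rewrite /= -expr2 sqrf_eq0.
Qed.

Lemma enormD_sqr u v :
  enorm (u + v) ^+ 2 = enorm u ^+ 2 + 2 * dot u v + enorm v ^+ 2.
Proof.
rewrite !enorm_sqr dotDr (dotC _ u) (dotC _ v) !dotDr (dotC v u); ring.
Qed.

(** Cauchy-Schwarz, by expanding the squared norm of [enorm v *: u - enorm u *: v]; vectors of norm
    zero are set apart so that the product of the norms can be divided out. *)
Lemma dot_le u v : dot u v <= enorm u * enorm v.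
Proof.
have [u0|u0] := eqVneq (enorm u) 0.
  by rewrite u0 mul0r (enorm_eq0 u0) dotC /dot big1// => k _; rewrite mxE mulr0.
have [v0|v0] := eqVneq (enorm v) 0.
  by rewrite v0 mulr0 (enorm_eq0 v0) /dot big1// => k _; rewrite mxE mulr0.
have := sqr_ge0 (enorm (enorm v *: u + (- enorm u) *: v)).
rewrite enormD_sqr dotZr (dotC _ v) dotZr (dotC v) !enormZ normrN.
rewrite !(ger0_norm (enorm_ge0 _)).
set a := enorm u; set b := enorm v; set c := dot u v => h.
have ab : 0 < a * b by rewrite mulr_gt0// lt_neqAle eq_sym enorm_ge0 andbT.
rewrite -(ler_pM2l ab); nra.
Qed.

Lemma dot_abs_le u v : `|dot u v| <= enorm u * enorm v.
Proof. by rewrite ler_norml dot_le andbT lerNl -dotNr -(enormN v) dot_le. Qed.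

Lemma enormD u v : enorm (u + v) <= enorm u + enorm v.
Proof.
rewrite -ler_sqr ?nnegrE ?addr_ge0 ?enorm_ge0// enormD_sqr.
have := dot_le u v; nra.
Qed.

Lemma enorm_le_dist u v : enorm u <= enorm v + enorm (u - v).
Proof. by rewrite -{1}(subrKC v u) enormD. Qed.

Lemma enorm_sum (I : Type) (r : seq I) (F : I -> 'rV[R]_d) :
  enorm (\sum_(i <- r) F i) <= \sum_(i <- r) enorm (F i).
Proof.
elim/big_rec2: _ => [|i y1 y2 _ h]; first by rewrite enorm0.
by rewrite (le_trans (enormD _ _))// lerD2l.
Qed.

Lemma enorm_le_sum u : enorm u <= \sum_(k < d) `|u 0 k|.
Proof.
have u_ge0 : 0 <= \sum_(k < d) `|u 0 k| by apply: sumr_ge0.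
rewrite -ler_sqr ?nnegrE ?enorm_ge0// enorm_sqr.
apply: le_trans (_ : \sum_(k < d) `|u 0 k| * \sum_(j < d) `|u 0 j| <= _).
  apply: ler_sum => k _; rewrite -expr2 -real_normK ?num_real// expr2.
  by rewrite ler_wpM2l// (bigD1 k)//= lerDl sumr_ge0.
by rewrite -big_distrl/= expr2.
Qed.

Lemma coord_le_enorm u k : `|u 0 k| <= enorm u.
Proof.
rewrite -ler_sqr ?nnegrE ?enorm_ge0 ?normr_ge0// enorm_sqr /dot (bigD1 k)//=.
by rewrite -expr2 real_normK ?num_real// lerDl sumr_ge0// => j _; rewrite -expr2 sqr_ge0.
Qed.

End EuclideanNorm.

Section PowerSums.
Variable R : realType.

(** Writing (n-1)^(-e) as n^(-e) exp(e ln(n/(n-1))), it suffices that exp(x) >= 1 + x and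
    ln(n/(n-1)) = -ln(1 - 1/n) >= 1/n. *)
Lemma powR_telescope (e : R) (n : nat) : 0 < e -> (1 < n)%N ->
  e * n%:R `^ (- (1 + e)) <= n.-1%:R `^ (- e) - n%:R `^ (- e).
Proof.
case: n => [//|n] e0; rewrite ltnS /= => n0.
have n0' : (0 : R) < n%:R by rewrite ltr0n.
have m0 : (0 : R) < n.+1%:R by rewrite ltr0n.
have -> : - (1 + e) = (- e) + (- 1) by rewrite opprD addrC.
rewrite powRD; last by apply/implyP => _; rewrite gt_eqF.
rewrite powR_inv1 ?(ltW m0)//.
have -> : n%:R `^ (- e) = n.+1%:R `^ (- e) * expR (e * ln (n.+1%:R / n%:R)).
  rewrite /powR !gt_eqF// -expRD; congr expR.
  rewrite ln_div ?posrE//; ring.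
rewrite mulrCA; set P := n.+1%:R `^ (- e); set E := expR _.
rewrite (_ : P * E - P = P * (E - 1)); last by ring.
rewrite ler_wpM2l ?powR_ge0// {}/E.
have h : 1 + e * ln (n.+1%:R / n%:R) <= expR (e * ln (n.+1%:R / n%:R)).
  exact: expR_ge1Dx.
apply: le_trans (_ : e * ln (n.+1%:R / n%:R) <= _); last by rewrite lerBrDl.
rewrite ler_wpM2l ?(ltW e0)//.
have -> : n.+1%:R / n%:R = (1 + (- n.+1%:R^-1))^-1 :> R.
  have : (n.+1%:R : R) = n%:R + 1 by rewrite -natr1.
  by move=> h'; rewrite h' in m0 *; field; rewrite !gt_eqF//=; lra.
have pos : (0 : R) < 1 + - n.+1%:R^-1.
  by rewrite subr_gt0 invf_lt1// ltr1n ltnS.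
by rewrite lnV ?posrE// lerNr le_ln1Dx// ltrN2 invf_lt1// ltr1n ltnS.
Qed.

Lemma powR_sum_bounded (s : R) : 1 < s ->
  exists2 C : R, 0 <= C & forall T, \sum_(1 <= t < T.+1) t%:R `^ (- s) <= C.
Proof.
move=> s1; set e := s - 1; have e0 : 0 < e by rewrite subr_gt0.
exists (1 + e^-1); first by rewrite addr_ge0// invr_ge0 ltW.
(* The telescoped remainder T^(-e) is kept in the bound so that the induction closes. *)
suff h T : (0 < T)%N ->
    \sum_(1 <= t < T.+1) t%:R `^ (- s) <= 1 + e^-1 * (1 - T%:R `^ (- e)).
  case=> [|T]; first by rewrite big_geq// addr_ge0// invr_ge0 ltW.
  apply: le_trans (h _ _) _ => //; rewrite lerD2l -[leRHS]mulr1 ler_wpM2l ?gerBl ?powR_ge0//.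
  by rewrite invr_ge0 ltW.
elim: T => // -[_ _|T IH _].
  by rewrite big_nat1 !powR1 subrr mulr0 addr0.
rewrite big_nat_recr//=; apply: le_trans (lerD (IH _) (lexx _)) _ => //.
have := @powR_telescope e T.+2 e0 isT.
have -> : - (1 + e) = - s by rewrite /e; ring.
rewrite /= -ler_pdivlMl// => h.
by rewrite -addrA lerD2l; apply: le_trans (lerD (lexx _) h) _; rewrite -mulrDr; lra.
Qed.

End PowerSums.

(** * Consensus *)

Section Consensus.
Variables (R : realType) (N : nat).
Implicit Types z : 'I_N -> R.

(** The base value 0 of the maximum is what the pairs (i, i) contribute anyway; it fixes the value
    for an empty index set. *)
Definition osc z : R := \big[Num.max/0]_(ij : 'I_N * 'I_N) (z ij.1 - z ij.2).

Lemma osc_ge0 z : 0 <= osc z.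
Proof. exact: bigmax_ge_id. Qed.

Lemma osc_ub z i j : z i - z j <= osc z.
Proof. exact: (le_bigmax _ (fun ij => z ij.1 - z ij.2) (i, j)). Qed.

Lemma osc_le z D : 0 <= D -> (forall i j, z i - z j <= D) -> osc z <= D.
Proof. by move=> D0 h; apply: bigmax_le => // -[i j] _; exact: h. Qed.

Variables (eta : R) (B : nat) (W : nat -> 'M[R]_N) (E : nat -> rel 'I_N).
Hypotheses (eta01 : 0 < eta < 1) (network : network_assumption eta B W E).

(** Unperturbed averaging: the product of the matrices of rounds s, ..., s + m - 1 applied to
    [z]. *)
Fixpoint evol (s m : nat) z : 'I_N -> R :=
  if m is m'.+1 then fun i => \sum_j W (s + m')%N i j * evol s m' z j else z.

Variable s : nat.
Hypothesis s_gt0 : (0 < s)%N.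

Let W_ge0 m i j : 0 <= W (s + m)%N i j.
Proof. by case: network => _ /(_ (s + m)%N (ltn_addr _ s_gt0))[]. Qed.

Let W_row m i : \sum_j W (s + m)%N i j = 1.
Proof. by case: network => _ /(_ (s + m)%N (ltn_addr _ s_gt0))[]. Qed.

Lemma evol_lb z c m i : (forall j, c <= z j) -> c <= evol s m z i.
Proof.
move=> zc; elim: m i => [|m IH] i //=.
rewrite -[c]mul1r -(W_row m i) big_distrl /=.
by apply: ler_sum => j _; rewrite ler_wpM2l.
Qed.

Lemma evol_ub z c m i : (forall j, z j <= c) -> evol s m z i <= c.
Proof.
move=> zc; elim: m i => [|m IH] i //=.
rewrite -[c]mul1r -(W_row m i) big_distrl /=.
by apply: ler_sum => j _; rewrite ler_wpM2l.
Qed.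

Section Spreading.
Variables (z : 'I_N -> R) (c D : R) (j0 : 'I_N).
Hypotheses (z_lb : forall i, c <= z i) (D0 : 0 <= D) (z_j0 : c + D <= z j0).

(** The agents that hold at least a fraction eta^m of the initial excess [D] of agent [j0] over the
    common lower bound [c]. *)
Definition informed m : {set 'I_N} :=
  [set i | c + eta ^+ m * D <= evol s m z i].

(** The row of [i] sums to 1 and every value is at least [c], so the excess of [j] reaches [i]
    multiplied by a weight that is at least [eta]. *)
Lemma informed_step m i j :
  in_nbh E (s + m)%N i j -> j \in informed m -> i \in informed m.+1.
Proof.
case: network => /(_ (s + m)%N i j (ltn_addr _ s_gt0))[eW _] _ _ /eW eta_le.
rewrite !inE => hj; rewrite [evol _ m.+1 _ _]/=.
apply: le_trans (_ : \sum_k W (s + m)%N i k * c + W (s + m)%N i j * (eta ^+ m * D) <= _).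
  rewrite -big_distrl/= W_row mul1r lerD2l exprS -mulrA ler_wpM2r// mulr_ge0//.
  by rewrite exprn_ge0// ltW//; case/andP: eta01.
rewrite (bigD1 j)//= [leRHS](bigD1 j)//= addrAC -mulrDr lerD ?ler_wpM2l//.
by apply: ler_sum => k _; rewrite ler_wpM2l// evol_lb.
Qed.

(** Each agent belongs to its own neighbourhood, so an informed agent stays informed. *)
Lemma informed_mono m k : (m <= k)%N -> informed m \subset informed k.
Proof.
move=> /subnK <-; elim: (k - m)%N => [|l IH]; first exact: subxx.
rewrite addSn; move: (l + m)%N IH => q IH; apply: (fintype.subset_trans IH).
apply/fintype.subsetP => i; apply: informed_step.
by rewrite /in_nbh eqxx orbT.
Qed.

(** If nothing were gained over [B] rounds, take a path of the union graph from an agent outside the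
    set to [j0]. Some edge of it leads from an outside agent [u] to an inside agent [v]; in the
    round of this edge [u] averages the value of [v] and becomes informed, a contradiction. *)
Lemma informed_grow m : informed m != [set: _]%SET ->
  (#|informed m| < #|informed (m + B)|)%N.
Proof.
move=> mT; apply/proper_card; rewrite fintype.properE informed_mono ?leq_addr//=.
apply/negP => sub.
have j0m : j0 \in informed m.
  by rewrite (fintype.subsetP (informed_mono (leq0n m)))// inE expr0 mul1r.
have [i inotin] : exists i, i \notin informed m.
  apply/existsP; apply: contraR mT => /existsPn h.
  by apply/eqP/finset.setP => i; rewrite [RHS]inE -[LHS]negbK h.
case: network => _ _ /(_ (s + m)%N (ltn_addr _ s_gt0) i j0)/connectP[q + j0q].
elim: q i inotin j0q => [|v q IH] u unotin /= j0q.
  by rewrite -j0q j0m in unotin.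
move=> /andP[/existsP[l uv]]; apply: IH j0q.
apply: contra unotin => vin.
rewrite (fintype.subsetP sub)// (fintype.subsetP (@informed_mono (m + l).+1 _ _))//.
  by rewrite -addnS leq_add2l ltn_ord.
apply: (@informed_step _ u v).
  by rewrite /in_nbh addnA uv.
by rewrite (fintype.subsetP (@informed_mono m _ _))// leq_addr.
Qed.

(** Each window of [B] rounds adds an agent until all are reached, so [k] windows inform at least
    min(k + 1, N) of them. *)
Lemma informed_all : informed (N * B) = [set: _]%SET.
Proof.
have h k : (minn k.+1 N <= #|informed (k * B)|)%N.
  elim: k => [|k IH].
    rewrite (leq_trans (geq_minl _ _))// card_gt0; apply/set0Pn; exists j0.
    by rewrite inE mul0n expr0 mul1r.
  have [full|nfull] := eqVneq (informed (k * B)) [set: _]%SET.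
    rewrite (leq_trans (geq_minr _ _))//.
    rewrite -{1}(card_ord N) -cardsT -full subset_leq_card// informed_mono//.
    by rewrite mulSn leq_addl.
  have := informed_grow nfull; rewrite mulSn addnC; apply: leq_trans.
  rewrite (leq_trans _ (_ : (minn k.+1 N).+1 <= _)%N) ?ltnS//.
  by rewrite -minnSS leq_min geq_minl (leq_trans (geq_minr _ _)).
apply/eqP; rewrite eqEcard finset.subsetT cardsT card_ord.
by rewrite (leq_trans _ (h N))// leq_min leqnn leqnSn.
Qed.

End Spreading.

(** Start the spreading from a maximal agent, with [c] the minimum: after [N * B] rounds every value
    exceeds the old minimum by at least eta^(N B) times the oscillation, while none exceeds the old
    maximum. *)
Lemma osc_evol z :
  osc (evol s (N * B) z) <= (1 - eta ^+ (N * B)) * osc z.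
Proof.
have [eta0 eta1] := andP eta01.
have m1 : 0 <= 1 - eta ^+ (N * B) by rewrite subr_ge0 exprn_ile1// ltW.
apply: osc_le => [|i j]; first by rewrite mulr_ge0// osc_ge0.
have [i0 _ min_i0] := @arg_minP _ _ _ i xpredT z isT.
have [j0 _ max_j0] := @arg_maxP _ _ _ i xpredT z isT.
have iub : evol s (N * B) z i <= z j0 by apply: evol_ub => k; exact: max_j0.
have : j \in informed z (z i0) (z j0 - z i0) (N * B).
  rewrite (@informed_all _ _ _ j0) ?inE//; first by move=> k; exact: min_i0.
    by rewrite subr_ge0 min_i0.
  by rewrite addrC subrK.
rewrite inE => jlb; have := osc_ub z j0 i0; nra.
Qed.

Variables (T : nat) (e : nat -> R) (z : nat -> 'I_N -> R).
Hypothesis z_step : forall t i, (1 <= t <= T)%N ->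
  `|z t.+1 i - \sum_j W t i j * z t j| <= e t.

(** Averaging does not expand the sup norm, so the perturbations of the rounds merely add up. *)
Lemma evol_perturbed m i : (s + m <= T.+1)%N ->
  `|z (s + m)%N i - evol s m (z s) i| <= \sum_(s <= r < s + m) e r.
Proof.
elim: m i => [|m IH] i sm; first by rewrite addn0 subrr normr0 big_geq.
rewrite addnS big_nat_recr ?leq_addr//=.
set S := \sum_j _.
rewrite (_ : _ - S = (z (s + m).+1 i - \sum_j W (s + m)%N i j * z (s + m)%N j) +
  \sum_j W (s + m)%N i j * (z (s + m)%N j - evol s m (z s) j)); last first.
  rewrite -[RHS]addrA; congr (_ + _); rewrite /S -!sumrN -big_split/=.
  by apply: eq_bigr => j _; ring.
rewrite addrC (le_trans (ler_normD _ _))// lerD//.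
  by rewrite z_step// (leq_trans s_gt0) ?leq_addr//= -ltnS -addnS.
apply: le_trans (ler_norm_sum _ _ _) _.
rewrite -[leRHS]mul1r -(W_row m i) big_distrl/=; apply: ler_sum => j _.
rewrite normrM ger0_norm// ler_wpM2l// IH//.
by rewrite (leq_trans _ sm)// addnS.
Qed.

Lemma osc_contract : (s + N * B <= T.+1)%N ->
  osc (z (s + N * B)%N) <= (1 - eta ^+ (N * B)) * osc (z s)
    + 2 * \sum_(s <= r < s + N * B) e r.
Proof.
move=> sm; have [eta0 eta1] := andP eta01.
have m1 : 0 <= 1 - eta ^+ (N * B) by rewrite subr_ge0 exprn_ile1// ltW.
have h := @evol_perturbed (N * B).
apply: osc_le => [|i j].
  rewrite addr_ge0 ?mulr_ge0 ?osc_ge0// big_nat; apply: sumr_ge0 => r /andP[sr rm].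
  have rT : (1 <= r <= T)%N.
    by rewrite (leq_trans s_gt0 sr)/= -ltnS (leq_trans rm sm).
  (* The sign of [e r] is read off [z_step] at some agent; a nonempty window guarantees that one
     exists. *)
  have N0 : (0 < N)%N.
    by rewrite lt0n; apply: contraTneq rm => ->; rewrite mul0n addn0 -leqNgt.
  exact: le_trans (z_step (Ordinal N0) rT).
have := h i sm; have := h j sm; rewrite !ler_norml => /andP[h1 h2] /andP[h3 h4].
have := osc_ub (evol s (N * B) (z s)) i j; have := osc_evol (z s).
lra.
Qed.

End Consensus.

(* Summing the contraction against the nonincreasing weights [h] avoids
   unrolling it into a geometric convolution. *)
Lemma weighted_contraction_sum (R : realType) (m T : nat) (rho D : R)
    (h o e : nat -> R) :
  0 <= rho < 1 -> 0 <= D ->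
  (forall t, 0 <= h t) -> (forall t, 0 <= e t) -> (forall t, 0 <= o t) ->
  (forall t u, (1 <= t <= u)%N -> h u <= h t) ->
  (forall t, (1 <= t <= T)%N -> o t <= D) ->
  (forall t, (1 <= t)%N -> (t + m <= T)%N ->
     o (t + m)%N <= rho * o t + 2 * \sum_(t <= r < t + m) e r) ->
  \sum_(1 <= t < T.+1) h t * o t <=
    (1 - rho)^-1 * (m%:R * (h 1%N * D) +
                    2 * m%:R * \sum_(1 <= t < T.+1) h t * e t).
Proof.
move=> /andP[rho0 rho1] D0 h0 e0 o0 hmono oD ostep.
have he0 : 0 <= \sum_(1 <= t < T.+1) h t * e t.
  by apply: sumr_ge0 => t _; rewrite mulr_ge0.
(* The first [m] rounds precede any contraction and are bounded crudely by [D]. *)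
have head n : (n <= m)%N -> (n <= T)%N ->
    \sum_(1 <= t < n.+1) h t * o t <= m%:R * (h 1%N * D).
  move=> nm nT; apply: le_trans (_ : \sum_(1 <= t < n.+1) (h 1%N * D) <= _).
    rewrite big_nat [leRHS]big_nat; apply: ler_sum => t /andP[t1 tn].
    by rewrite ler_pM// ?hmono//= ?t1// oD// t1/= (leq_trans _ nT)// -ltnS.
  rewrite big_const_nat iter_addr_0 subSS subn0 -[(_ * D) *+ n]mulr_natl ler_wpM2r ?mulr_ge0//.
  by rewrite ler_nat.
rewrite ler_pdivlMl ?subr_gt0//.
have [Tm|mT] := leqP T m.
  have := head _ Tm (leqnn T).
  have : 0 <= \sum_(1 <= t < T.+1) h t * o t.
    by apply: sumr_ge0 => t _; rewrite mulr_ge0.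
  set S := \sum_(1 <= t < T.+1) _ => S0 hS.
  have : 0 <= 2 * m%:R * \sum_(1 <= t < T.+1) h t * e t by rewrite !mulr_ge0.
  have : 0 <= rho * S by rewrite mulr_ge0.
  lra.
(* Each later round is compared with the one [m] rounds earlier; monotonicity allows replacing its
   weight by an earlier one. *)
have tail : \sum_(m.+1 <= t < T.+1) h t * o t <=
    rho * \sum_(1 <= t < T.+1) h t * o t +
    2 * m%:R * \sum_(1 <= t < T.+1) h t * e t.
  have -> : \sum_(m.+1 <= t < T.+1) h t * o t =
      \sum_(1 <= t < T.+1 - m) h (t + m)%N * o (t + m)%N.
    by rewrite -{1}(add1n m) big_addn.
  apply: le_trans (_ : \sum_(1 <= t < T.+1 - m) (rho * (h t * o t) +
     2 * \sum_(l < m) h (t + l)%N * e (t + l)%N) <= _).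
    rewrite big_nat [leRHS]big_nat; apply: ler_sum => t /andP[t1 tT].
    have tmT : (t + m <= T)%N by rewrite addnC -ltnS -ltn_subRL.
    apply: le_trans (ler_wpM2l (h0 _) (ostep t t1 tmT)) _.
    rewrite mulrDr; apply: lerD.
      by rewrite mulrCA ler_wpM2l// ler_wpM2r// hmono// t1 leq_addr.
    have -> : \sum_(t <= r < t + m) e r = \sum_(l < m) e (t + l)%N.
      rewrite -{1}(add0n t) big_addn addKn big_mkord.
      by apply: eq_bigr => l _; rewrite addnC.
    rewrite mulrCA ler_wpM2l// big_distrr/=; apply: ler_sum => l _.
    rewrite ler_wpM2r// hmono// (leq_trans t1) ?leq_addr//=.
    by rewrite leq_add2l ltnW.
  rewrite big_split/= -!big_distrr/= lerD//.
    rewrite ler_wpM2l// (@big_cat_nat _ _ _ (T.+1 - m) 1 T.+1)/=; last 2 first.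
    - by rewrite subn_gt0 ltnS ltnW.
    - by rewrite leq_subr.
    by rewrite lerDl; apply: sumr_ge0 => t _; rewrite mulr_ge0.
  (* After exchanging the sums, each of the [m] shifts [l] yields a piece of the full error sum. *)
  rewrite -mulrA ler_wpM2l// exchange_big/=.
  apply: le_trans (_ : \sum_(l < m) \sum_(1 <= t < T.+1) h t * e t <= _).
    apply: ler_sum => l _.
    have -> : \sum_(1 <= t < T.+1 - m) h (t + l)%N * e (t + l)%N =
        \sum_(1 + l <= t < T.+1 - m + l) h t * e t.
      by rewrite big_addn addnK.
    have lm := ltn_ord l.
    rewrite (@big_cat_nat _ _ _ (1 + l) 1 T.+1)/=; last 2 first.
    - by rewrite leq_addr.
    - by rewrite add1n ltnS (leq_trans (ltnW lm) (ltnW mT)).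
    rewrite (@big_cat_nat _ _ _ (T.+1 - m + l) (1 + l) T.+1)/=; last 2 first.
    - by rewrite leq_add2r subn_gt0 ltnS ltnW.
    - by rewrite -[leqRHS](subnK (leqW (ltnW mT))) leq_add2l ltnW.
    rewrite addrCA lerDl; apply: addr_ge0.
      by apply: sumr_ge0 => t _; rewrite mulr_ge0.
    by apply: sumr_ge0 => t _; rewrite mulr_ge0.
  by rewrite sumr_const card_ord mulr_natl.
(* The full sum S satisfies S <= head + rho S + errors, which is solved for S. *)
rewrite (@big_cat_nat _ _ _ m.+1 1 T.+1)//= in tail *; last by rewrite ltnS ltnW.
have := head m (leqnn m) (ltnW mT).
set S1 := \sum_(1 <= t < m.+1) _ in tail *.
set S2 := \sum_(m.+1 <= t < T.+1) _ in tail *.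
lra.
Qed.

(** * Gradients of smooth functions *)

Section Gradient.
Variables (R : realType) (d : nat).
Implicit Types (f : 'rV[R]_d -> R) (x y v : 'rV[R]_d).

Lemma dot_grad f x v : dot (grad f x) v = 'd f x v.
Proof.
rewrite {2}(row_sum_delta v) linear_sum; apply: eq_bigr => k _.
by rewrite linearZ mxE mulrC.
Qed.

Lemma is_derive_line f x v (s : R) : differentiable f (x + s *: v) ->
  is_derive s (1 : R) (fun r : R => f (x + r *: v)) (dot (grad f (x + s *: v)) v).
Proof.
move=> df; rewrite dot_grad -deriveE//.
have E : (fun h : R => h^-1 *: (((fun r : R => f (x + r *: v)) \o shift s)
      (h *: (1 : R)) - f (x + s *: v))) =
    (fun h : R => h^-1 *: ((f \o shift (x + s *: v)) (h *: v) - f (x + s *: v))).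
  apply/funext => h /=; congr (_ *: (f _ - _)).
  by rewrite [h *: 1]mulr1 scalerDl addrCA.
apply: DeriveDef; first by rewrite /derivable E; exact: diff_derivable.
by rewrite /derive E.
Qed.

(* The mean value theorem only gives the constant [L] in place of the usual
   [L / 2], which is enough here. *)
Lemma smooth_upper_bound f (L : R) x y :
  (forall z, differentiable f z) ->
  (forall z z', enorm (grad f z - grad f z') <= L * enorm (z - z')) ->
  f y <= f x + dot (grad f x) (y - x) + L * enorm (y - x) ^+ 2.
Proof.
move=> df lipf; set v := y - x.
have dF (s : R) := is_derive_line (df (x + s *: v)).
have [|c /andP[c0 c1]] := @MVT_segment R (fun r => f (x + r *: v))
    (fun r => dot (grad f (x + r *: v)) v) 0 1 ler01 (fun s _ => dF s).
  by apply: derivable_within_continuous => s _; case: (dF s).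
move: c0 c1; rewrite !bnd_simp => c0 c1.
rewrite !subr0 mulr1 scale0r addr0 scale1r {1}/v subrKC => h.
(* The sign of [L] is unknown; the Lipschitz bound itself makes this product nonnegative. *)
have Lv : 0 <= L * enorm v by exact: le_trans (enorm_ge0 _) (lipf y x).
have lip := lipf (x + c *: v) x.
rewrite [X in _ <= L * enorm X]addrC addKr enormZ (ger0_norm c0) in lip.
clear dF; clearbody v.
move: h lip; move: (grad f (x + c *: v)) (grad f x) => A A0 h lip.
have lip' : enorm (A - A0) <= L * enorm v.
  by apply: le_trans lip _; rewrite mulrCA; exact: ler_piMl.
have := dot_le (A - A0) v; rewrite dotBl.
have := ler_wpM2r (enorm_ge0 v) lip'; rewrite -mulrA -expr2.
lra.
Qed.

Lemma grad_sum (I : finType) (F : I -> 'rV[R]_d -> R) x :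
  (forall i, differentiable (F i) x) ->
  grad (fun y => \sum_i F i y) x = \sum_i grad (F i) x.
Proof.
move=> dF; apply/rowP => k; rewrite !mxE summxE.
under eq_bigr do rewrite mxE.
have -> : (fun y => \sum_i F i y) = \sum_i F i.
  by apply/funext => y; rewrite fct_sumE.
suff [] : differentiable (\sum_i F i) x /\
    'd (\sum_i F i) x (delta_mx 0 k) = \sum_i 'd (F i) x (delta_mx 0 k) by [].
elim/big_rec2: _ => [|i z G _ [dG IH]].
  by rewrite diff_cst; split=> //; exact: differentiable_cst.
split; first exact: differentiableD.
by rewrite diffD//= IH.
Qed.

End Gradient.

(** * Measurability *)

Section Measurability.
Context {disp : measure_display} {T : measurableType disp} {R : realType}.
Variable d : nat.
Implicit Types (u v : T -> 'rV[R]_d).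

(** Stated by coordinates, so that only real-valued functions occur and the sigma-field on the
    domain can vary with the round. *)
Definition vmeasurable u := forall k, measurable_fun setT (fun w => u w 0 k).

Lemma vmeasurableD u v :
  vmeasurable u -> vmeasurable v -> vmeasurable (fun w => u w + v w).
Proof.
move=> mu mv k; under eq_fun do rewrite mxE.
exact: measurable_funD (mu k) (mv k).
Qed.

Lemma vmeasurableM (f : T -> R) u : measurable_fun setT f -> vmeasurable u ->
  vmeasurable (fun w => f w *: u w).
Proof.
move=> mf mu k; under eq_fun do rewrite mxE.
exact: measurable_funM mf (mu k).
Qed.

Lemma vmeasurableZ (c : R) u : vmeasurable u -> vmeasurable (fun w => c *: u w).
Proof. exact: vmeasurableM. Qed.

Lemma vmeasurableB u v :
  vmeasurable u -> vmeasurable v -> vmeasurable (fun w => u w - v w).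
Proof.
move=> mu mv; apply: vmeasurableD => // k.
under eq_fun do rewrite -scaleN1r; exact: vmeasurableZ.
Qed.

Lemma vmeasurable_sum (I : Type) (r : seq I) (u_ : I -> T -> 'rV[R]_d) :
  (forall i, vmeasurable (u_ i)) -> vmeasurable (fun w => \sum_(i <- r) u_ i w).
Proof.
move=> mu k; under eq_fun do rewrite summxE.
by apply: measurable_sum => i; exact: mu.
Qed.

Lemma measurable_dot u v :
  vmeasurable u -> vmeasurable v -> measurable_fun setT (fun w => dot (u w) (v w)).
Proof.
move=> mu mv; apply: measurable_sum => k; exact: measurable_funM (mu k) (mv k).
Qed.

Lemma measurable_enorm u :
  vmeasurable u -> measurable_fun setT (fun w => enorm (u w)).
Proof.
move=> mu; have -> : (fun w => enorm (u w)) = fun w => (dot (u w) (u w)) `^ (2^-1).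
  apply/funext => w; rewrite powR12_sqrt -enorm_sqr ?sqr_ge0//.
  by rewrite sqrtr_sqr ger0_norm// enorm_ge0.
by apply: (measurableT_comp (measurable_powR _)); exact: measurable_dot.
Qed.

Lemma vmeasurable_clip (lam : R) u :
  vmeasurable u -> vmeasurable (fun w => clip lam (u w)).
Proof.
move=> mu; apply: vmeasurableM => //; apply: measurable_minr => //.
apply: measurable_funM => //.
have -> : (fun w => (enorm (u w))^-1) = fun w => enorm (u w) `^ (-1).
  by apply/funext => w; rewrite powR_inv1// enorm_ge0.
by apply: (measurableT_comp (measurable_powR _)); exact: measurable_enorm.
Qed.

(* A Lipschitz function is the infimum of its upper cones at rational points,
   so its sublevel sets are countable unions of l1 balls. *)
Lemma measurable_lipschitz (phi : 'rV[R]_d -> R) (L : R) u :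
  (forall y z, phi y - phi z <= L * enorm (y - z)) ->
  vmeasurable u -> measurable_fun setT (fun w => phi (u w)).
Proof.
move=> lip mu.
have lip1 y z : phi y - phi z <= `|L| * \sum_k `|y 0 k - z 0 k|.
  apply: le_trans (lip y z) _; apply: le_trans (ler_wpM2r _ (ler_norm L)) _.
    exact: enorm_ge0.
  rewrite ler_wpM2l//; apply: le_trans (enorm_le_sum _) _.
  by under eq_bigr do rewrite !mxE.
pose q (z : 'rV[rat]_d) : 'rV[R]_d := map_mx ratr z.
pose cone z w := phi (q z) + `|L| * \sum_k `|u w 0 k - q z 0 k|.
have mcone z : measurable_fun setT (cone z).
  apply: measurable_funD => //; apply: measurable_funM => //.
  apply: measurable_sum => k; apply: measurableT_comp => //.
  exact: measurable_funB.
apply: (measurability _ (RGenInftyO.measurableE R)).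
move=> _ [_ [c ->] <-].
rewrite (_ : _ `&` _ = \bigcup_z (setT `&` cone z @^-1` `]-oo, c[)).
  apply: countable_bigcupT_measurable => [|z]; first exact: countableP.
  by apply: mcone => //; exact: measurable_itv.
rewrite -setI_bigcupr; congr (_ `&` _); apply/seteqP; split => w /=.
  rewrite in_itv/= => phi_c.
  have d1 : 0 < 2 * `|L| * d%:R + 1 by rewrite ltr_wpDl// !mulr_ge0.
  (* Moving to a rational point within [eps] in each coordinate costs at most |L| d eps in [phi] and
     as much again in the cone; the added 1 keeps the total strictly below the gap c - phi(u w). *)
  pose eps := (c - phi (u w)) / (2 * `|L| * d%:R + 1).
  have eps0 : 0 < eps by rewrite divr_gt0// subr_gt0.
  have /choice[r hr] k : exists r : rat, `|u w 0 k - ratr r| <= eps.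
    have [|r] := @rat_in_itvoo R (u w 0 k) (u w 0 k + eps); first by rewrite ltrDl.
    rewrite in_itv/= => /andP[r1 r2]; exists r.
    by rewrite distrC gtr0_norm ?subr_gt0// lerBlDl ltW.
  pose z : 'rV[rat]_d := \row_k r k.
  have sumz : \sum_k `|u w 0 k - q z 0 k| <= d%:R * eps.
    rewrite mulr_natl -[in leRHS](card_ord d) -sumr_const.
    by apply: ler_sum => k _; rewrite !mxE.
  exists z => //=; rewrite in_itv/= /cone.
  have := lip1 (q z) (u w); under eq_bigr do rewrite distrC.
  have : eps * (2 * `|L| * d%:R + 1) = c - phi (u w).
    by rewrite /eps divfK// gt_eqF.
  have := ler_wpM2l (normr_ge0 L) sumz; move: sumz.
  set S := \sum_k _ => *; nra.
move=> [z _]; rewrite /= !in_itv/= /cone; apply: le_lt_trans.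
by have := lip1 (u w) (q z); rewrite lerBlDl.
Qed.

End Measurability.

(** * Conditional expectation *)

Section AlmostEverywhere.
Context {disp : measure_display} {T : measurableType disp} {R : realType}.
Variable P : probability T R.
Implicit Types f g V X : T -> R.

Lemma ae_eq_integrable f g : measurable_fun setT f ->
  {ae P, forall w, f w = g w} ->
  P.-integrable setT (EFin \o g) -> P.-integrable setT (EFin \o f).
Proof.
move=> mf fg /integrableP[mg ig]; apply/integrableP; split; first exact/measurable_EFinP.
rewrite (ae_eq_integral (fun x => `|(EFin \o g) x|%E))//.
- by apply: measurableT_comp => //; exact/measurable_EFinP.
- exact: measurableT_comp.
- by apply: filterS fg => w /= -> _.
Qed.

Lemma ae_eq_Rintegral f g : measurable_fun setT f -> measurable_fun setT g ->
  {ae P, forall w, f w = g w} -> \int[P]_w f w = \int[P]_w g w.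
Proof.
move=> mf mg fg; congr fine; apply: ae_eq_integral => //.
- exact/measurable_EFinP.
- exact/measurable_EFinP.
- by apply: filterS fg => w /= -> _.
Qed.

Lemma integrable_measurable f :
  P.-integrable setT (EFin \o f) -> measurable_fun setT f.
Proof. by move=> /measurable_int/measurable_EFinP. Qed.

Lemma ae_le_Rintegral f g : P.-integrable setT (EFin \o f) ->
  P.-integrable setT (EFin \o g) -> {ae P, forall w, f w <= g w} ->
  \int[P]_w f w <= \int[P]_w g w.
Proof.
move=> fi gi fg; rewrite -subr_ge0 -RintegralB//.
have mf := integrable_measurable fi; have mg := integrable_measurable gi.
rewrite (@ae_eq_Rintegral _ (fun w => Num.max (g w - f w) 0)).
- by apply: Rintegral_ge0 => w _; rewrite le_max lexx orbT.
- exact: measurable_funB.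
- by apply: measurable_maxr => //; exact: measurable_funB.
- by apply: filterS fg => w fgw; rewrite max_l// subr_ge0.
Qed.

(** [V] is bounded only almost everywhere, so it is replaced by its truncation to [-C, C], which is
    bounded everywhere and agrees with it almost everywhere. *)
Lemma ae_bounded_integrableM V X C : measurable_fun setT V ->
  {ae P, forall w, `|V w| <= C} -> P.-integrable setT (EFin \o X) ->
  P.-integrable setT (EFin \o (fun w => V w * X w)).
Proof.
move=> mV VC iX; have mX := integrable_measurable iX.
pose V' w := Num.max (- C) (Num.min C (V w)).
have mV' : measurable_fun setT V'.
  by apply: measurable_maxr => //; exact: measurable_minr.
apply: (@ae_eq_integrable _ (fun w => V' w * X w)).
- exact: measurable_funM.
- apply: filterS VC => w; rewrite ler_norml => /andP[h1 h2].
  by rewrite /V' min_r// max_r.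
apply: (le_integrable _ (g := fun w => (C%:E * (EFin \o X) w)%E)) => //.
- by apply/measurable_EFinP; exact: measurable_funM.
- move=> w _; rewrite /= lee_fin !normrM ler_wpM2r//.
  rewrite /V' ler_norml; apply/andP; split.
    by rewrite le_max lerN2 ler_norm.
  rewrite ge_max ge_min ler_norm/= andbT.
  by rewrite -normrN ler_norm.
- exact: integrableZl.
Qed.

Lemma ae_bounded_integrable V C : measurable_fun setT V ->
  {ae P, forall w, `|V w| <= C} -> P.-integrable setT (EFin \o V).
Proof.
move=> mV VC.
have := @ae_bounded_integrableM V (fun=> 1) C mV VC.
have -> : (fun w => V w * 1) = V by apply/funext => w; rewrite mulr1.
by apply; exact: (finite_measure_integrable_cst P 1).
Qed.

Lemma Rintegral_sum (I : Type) (r : seq I) (F : I -> T -> R) :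
  (forall i, P.-integrable setT (EFin \o F i)) ->
  P.-integrable setT (EFin \o (fun w => \sum_(i <- r) F i w)) /\
  \int[P]_w (\sum_(i <- r) F i w) = \sum_(i <- r) \int[P]_w F i w.
Proof.
move=> iF; elim: r => [|i r [IH1 IH2]].
  split; last first.
    under eq_Rintegral do rewrite big_nil.
    by rewrite big_nil Rintegral_cst// mul0r.
  have -> : (fun w => \sum_(i <- [::]) F i w) = cst 0.
    by apply/funext => w; rewrite big_nil.
  exact: (finite_measure_integrable_cst P 0).
split; last first.
  by under eq_Rintegral do rewrite big_cons; rewrite RintegralD// IH2 big_cons.
have -> : (fun w => \sum_(j <- i :: r) F j w) =
    (fun w => F i w + \sum_(j <- r) F j w).
  by apply/funext => w; rewrite big_cons.
exact: (integrableD _ (iF i) IH1).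
Qed.

End AlmostEverywhere.

Section ConditionalExpectation.
Context {disp : measure_display} {T : measurableType disp} {R : realType}.
Variables (P : probability T R) (G : set (set T)).
Hypothesis G_sub : G `<=` measurable.
Implicit Types U V X Y Z : T -> R.

Notation gmeasurable f :=
  (measurable_fun setT (f : g_sigma_algebraType G -> R)).

Lemma g_sigma_sub : <<s G >> `<=` measurable.
Proof. by apply: smallest_sub => //; exact: sigma_algebra_measurable. Qed.

Lemma gmeasurable_measurable V : gmeasurable V -> measurable_fun setT V.
Proof. by move=> mV _ A mA; apply: g_sigma_sub; exact: mV. Qed.

(* Halving: [U = (1_A + U') / 2] with [A = {U >= 1/2}] and [0 <= U' <= 1]. *)
Lemma integral_mul_orthogonal n Z U : P.-integrable setT (EFin \o Z) ->
  (forall A, <<s G >> A -> \int[P]_(w in A) Z w = 0) ->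
  gmeasurable U -> (forall w, 0 <= U w <= 1) ->
  `|\int[P]_w (U w * Z w)| <= 2^-1 ^+ n * \int[P]_w `|Z w|.
Proof.
move=> iZ Z0; elim: n U => [|n IH] U mU U01.
  have bU w : `|U w| <= 1 by have /andP[? ?] := U01 w; rewrite ger0_norm.
  have iUZ : P.-integrable setT (EFin \o (fun w => U w * Z w)).
    apply: (@ae_bounded_integrableM _ _ _ _ _ _ 1) => //.
      exact: gmeasurable_measurable.
    exact: aeW.
  rewrite expr0 mul1r; apply: le_trans (le_normr_Rintegral _ _) _ => //.
  apply: le_Rintegral => //; [exact: integrable_norm|exact: integrable_norm|].
  by move=> w _; rewrite normrM -[leRHS]mul1r ler_wpM2r.
pose A := [set w | 2^-1 <= U w].
have mA : <<s G >> A.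
  have := mU measurableT `[2^-1, +oo[%classic (measurable_itv _).
  rewrite setTI; congr (<<s G >> _).
  by apply/seteqP; split => w; rewrite /A/= in_itv/= andbT.
pose U' w := 2 * U w - \1_A w.
have mU' : gmeasurable U'.
  apply: measurable_funB; first exact: measurable_funM.
  exact: (@measurable_indic _ (g_sigma_algebraType G)).
have U'01 w : 0 <= U' w <= 1.
  have := U01 w; rewrite /U' indicE.
  case: (pselect (A w)) => [Aw|nAw].
    by rewrite mem_set//; move: Aw; rewrite /A/=; lra.
  by rewrite memNset//; move: nAw; rewrite /A/= => /negP; rewrite -ltNge; lra.
have i1Z : P.-integrable setT (EFin \o (fun w => \1_A w * Z w)).
  apply: (@ae_bounded_integrableM _ _ _ _ _ _ 1) => //.
    by apply: measurable_indic; exact: g_sigma_sub.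
  by apply: aeW => w; rewrite indicE ger0_norm ?lern1 ?leq_b1.
have iU'Z : P.-integrable setT (EFin \o (fun w => U' w * Z w)).
  apply: (@ae_bounded_integrableM _ _ _ _ _ _ 1) => //.
    exact: gmeasurable_measurable.
  by apply: aeW => w; have /andP[? ?] := U'01 w; rewrite ger0_norm.
have -> : \int[P]_w (U w * Z w) = 2^-1 * \int[P]_w (U' w * Z w).
  transitivity (\int[P]_w (2^-1 * (\1_A w * Z w) + 2^-1 * (U' w * Z w))).
    by apply: eq_Rintegral => w _; rewrite /U'; lra.
  rewrite RintegralD//; last 2 first.
  - exact: (integrableZl _ _ i1Z).
  - exact: (integrableZl _ _ iU'Z).
  rewrite !RintegralZl//.
  have -> : \int[P]_w (\1_A w * Z w) = \int[P]_(w in A) Z w.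
    rewrite [RHS]Rintegral_mkcond patch_indic.
    by apply: eq_Rintegral => w _ /=; rewrite mulrC.
  by rewrite Z0// mulr0 add0r.
rewrite normrM ger0_norm// exprS -mulrA ler_wpM2l//; exact: IH.
Qed.

(** The pull-out property. Almost everywhere [V] is an affine image of some [U] with values in
    [0, 1], and [integral_mul_orthogonal] for every [n] makes the integral of U (X - Y) vanish. *)
Lemma cond_exp_bounded_mul X Y V C : is_cond_exp P G X Y -> gmeasurable V ->
  {ae P, forall w, `|V w| <= C} ->
  \int[P]_w (V w * X w) = \int[P]_w (V w * Y w).
Proof.
move=> [iX iY mY XY] gV VC; have mV := gmeasurable_measurable gV.
have iVX := ae_bounded_integrableM mV VC iX.
have iVY := ae_bounded_integrableM mV VC iY.
apply/eqP; rewrite -subr_eq0 -RintegralB//.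
pose Z w := X w - Y w.
have iZ : P.-integrable setT (EFin \o Z) by exact: (integrableB _ iX iY).
have mZ := integrable_measurable iZ.
have Z0 A : <<s G >> A -> \int[P]_(w in A) Z w = 0.
  move=> GA; have mA := g_sigma_sub GA.
  rewrite /Z RintegralB//; last 2 first.
  - exact: integrableS iX.
  - exact: integrableS iY.
  by rewrite /Rintegral XY// subrr.
pose M := `|C| + 1; have M0 : 0 < M by rewrite ltr_wpDl.
pose U w := 2^-1 * (1 + Num.max (-1) (Num.min 1 (V w / M))).
have gU : gmeasurable U.
  apply: measurable_funM => //; apply: measurable_funD => //.
  apply: measurable_maxr => //; apply: measurable_minr => //.
  exact: measurable_funM.
have U01 w : 0 <= U w <= 1.
  rewrite /U; set m := Num.max _ _.
  have : -1 <= m by rewrite le_max lexx.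
  have : m <= 1 by rewrite ge_max ge_min lexx/= andbT; lra.
  by move=> ? ?; apply/andP; split; lra.
have iUZ : P.-integrable setT (EFin \o (fun w => U w * Z w)).
  apply: (@ae_bounded_integrableM _ _ _ _ _ _ 1) => //.
    exact: gmeasurable_measurable.
  by apply: aeW => w; have /andP[? ?] := U01 w; rewrite ger0_norm.
have UZ0 : \int[P]_w (U w * Z w) = 0.
  set a := \int[P]_w _; apply/eqP; rewrite -normr_eq0 eq_le normr_ge0 andbT.
  rewrite leNgt; apply/negP => a0.
  set I := \int[P]_w `|Z w|.
  have I0 : 0 <= I by exact: Rintegral_ge0.
  (* Since 2^n > n > I / |a|, the halving bound for this [n] contradicts |a| > 0. *)
  pose n := Num.bound (I / `|a|).
  have : I / `|a| < n%:R by rewrite archi_boundP// divr_ge0.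
  rewrite ltr_pdivrMr// => nI.
  have := integral_mul_orthogonal n iZ Z0 gU U01; rewrite -/a -/I exprVn.
  rewrite ler_pdivlMl ?exprn_gt0//; apply/negP; rewrite -ltNge.
  rewrite (lt_le_trans nI)// ler_wpM2r// -natrX ler_nat ltnW// ltn_expl//.
(* Inverting the affine map: V = 2 M U - M almost everywhere. *)
have -> : \int[P]_w (V w * X w - V w * Y w) =
    \int[P]_w (2 * M * (U w * Z w) - M * Z w).
  apply: ae_eq_Rintegral.
  - exact: measurable_funB (integrable_measurable iVX) (integrable_measurable iVY).
  - apply: measurable_funB; apply: measurable_funM => //.
    exact: (integrable_measurable iUZ).
  apply: filterS VC => w VCw; rewrite -mulrBr /U.
  have : `|V w / M| <= 1.
    rewrite normrM normfV (gtr0_norm M0) ler_pdivrMr// mul1r.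
    by have := ler_norm C; rewrite /M; move: VCw; lra.
  rewrite ler_norml => /andP[h1 h2]; rewrite min_r// max_r// /Z; field.
  by rewrite gt_eqF.
rewrite RintegralB//; last 2 first.
- exact: (integrableZl _ _ iUZ).
- exact: (integrableZl _ _ iZ).
rewrite !RintegralZl// UZ0 Z0 ?mulr0 ?subrr//.
exact: (@measurableT _ (g_sigma_algebraType G)).
Qed.

Lemma cond_exp_bounded_mul_le U Z V C s : is_cond_exp P G U Z ->
  {ae P, forall w, Z w <= s} -> gmeasurable V -> (forall w, 0 <= V w) ->
  {ae P, forall w, V w <= C} ->
  \int[P]_w (V w * U w) <= \int[P]_w (V w * s).
Proof.
move=> UZ Zs gV V0 VC; have mV := gmeasurable_measurable gV.
have VC' : {ae P, forall w, `|V w| <= C}.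
  by apply: filterS VC => w; rewrite ger0_norm.
rewrite (cond_exp_bounded_mul UZ gV VC'); case: UZ => iU iZ _ _.
apply: ae_le_Rintegral.
- exact: (ae_bounded_integrableM mV VC' iZ).
- apply: (ae_bounded_integrableM mV VC').
  exact: (finite_measure_integrable_cst P s).
- by apply: filterS Zs => w Zw; rewrite ler_wpM2l.
Qed.

(* One step of the exponential supermartingale: the pointwise bound on [expR X]
   is linear in the martingale differences [D] and the moments [U]. *)
Lemma exp_supermartingale_step (I J : finType) (V X q b : T -> R)
    (a D Y : J -> T -> R) (U Z : I -> T -> R) (CV CX Ca Cb s v : R) :
  gmeasurable V -> (forall w, 0 <= V w) -> {ae P, forall w, V w <= CV} ->
  measurable_fun setT X -> {ae P, forall w, X w <= CX} ->
  gmeasurable q -> (forall w, 0 <= q w) ->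
  gmeasurable b -> (forall w, 0 <= b w) -> {ae P, forall w, b w <= Cb} ->
  (forall j, gmeasurable (a j)) ->
  (forall j, {ae P, forall w, `|a j w| <= Ca}) ->
  (forall j, is_cond_exp P G (D j) (Y j)) ->
  (forall i, is_cond_exp P G (U i) (Z i)) ->
  (forall i, {ae P, forall w, Z i w <= s}) ->
  {ae P, forall w, expR (X w) <=
     1 + \sum_j a j w * (D j w - Y j w) + b w * \sum_i U i w} ->
  {ae P, forall w, #|I|%:R * s * b w <= q w + v} ->
  \int[P]_w (V w * expR (X w - q w)) <= expR v * \int[P]_w V w.
Proof.
move=> gV V0 VC mX XC gq q0 gb b0 bC ga aC DY UZ Zs Xle bq.
(* [q] is nonnegative and measurable for the conditioning sigma-field, so exp(-q) joins the bounded
   factor. *)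
pose V' w := V w * expR (- q w).
have gV' : gmeasurable V'.
  apply: measurable_funM => //; apply: measurableT_comp => //.
  exact: measurable_funN.
have V'0 w : 0 <= V' w by rewrite mulr_ge0// expR_ge0.
have V'C : {ae P, forall w, V' w <= CV}.
  apply: filterS VC => w; apply: le_trans.
  by rewrite -[leRHS]mulr1 ler_wpM2l// expR_le1 oppr_le0.
have mV' := gmeasurable_measurable gV'; have mV := gmeasurable_measurable gV.
have nrm (F : T -> R) (C : R) : (forall w, 0 <= F w) -> {ae P, forall w, F w <= C} ->
    {ae P, forall w, `|F w| <= C}.
  by move=> F0; apply: filterS => w; rewrite ger0_norm.
have iV : P.-integrable setT (EFin \o V) by apply: ae_bounded_integrable mV (nrm _ _ V0 VC).
have iV' : P.-integrable setT (EFin \o V').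
  exact: ae_bounded_integrable mV' (nrm _ _ V'0 V'C).
have gVa j : gmeasurable (fun w => V' w * a j w) by exact: measurable_funM.
have VaC j : {ae P, forall w, `|V' w * a j w| <= CV * Ca}.
  apply: filterS2 (nrm _ _ V'0 V'C) (aC j) => w h1 h2.
  by rewrite normrM ler_pM.
have gVb : gmeasurable (fun w => V' w * b w) by exact: measurable_funM.
have Vb0 w : 0 <= V' w * b w by rewrite mulr_ge0.
have VbC : {ae P, forall w, V' w * b w <= CV * Cb}.
  by apply: filterS2 V'C bC => w h1 h2; rewrite ler_pM.
have iVaX j (F : T -> R) : P.-integrable setT (EFin \o F) ->
    P.-integrable setT (EFin \o (fun w => V' w * a j w * F w)).
  exact: ae_bounded_integrableM (gmeasurable_measurable (gVa j)) (VaC j).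
have iVbX (F : T -> R) : P.-integrable setT (EFin \o F) ->
    P.-integrable setT (EFin \o (fun w => V' w * b w * F w)).
  exact: ae_bounded_integrableM (gmeasurable_measurable gVb) (nrm _ _ Vb0 VbC).
have iaD j : P.-integrable setT
    (EFin \o (fun w => V' w * a j w * D j w - V' w * a j w * Y j w)).
  by case: (DY j) => ? ? _ _; apply: (integrableB _ (iVaX _ _ _) (iVaX _ _ _)).
have ibU i : P.-integrable setT (EFin \o (fun w => V' w * b w * U i w)).
  by case: (UZ i) => ? ? _ _; exact: iVbX.
have [isD eD] := Rintegral_sum (index_enum J) iaD.
have [isU eU] := Rintegral_sum (index_enum I) ibU.
have iR : P.-integrable setT (EFin \o (fun w => V' w +
    \sum_j (V' w * a j w * D j w - V' w * a j w * Y j w) +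
    \sum_i (V' w * b w * U i w))).
  exact: (integrableD _ (integrableD _ iV' isD) isU).
have meX : measurable_fun setT (fun w => expR (X w - q w)).
  apply: measurableT_comp => //; apply: measurable_funB => //.
  exact: gmeasurable_measurable.
have iVX : P.-integrable setT (EFin \o (fun w => V w * expR (X w - q w))).
  apply: (@ae_bounded_integrable _ _ _ _ _ (CV * expR CX)).
    exact: measurable_funM.
  apply: filterS2 VC XC => w h1 h2.
  rewrite ger0_norm ?mulr_ge0 ?expR_ge0// ler_pM// ?expR_ge0//.
  by rewrite ler_expR lerBlDr (le_trans h2)// lerDl.
apply: le_trans (_ : \int[P]_w (V' w +
    \sum_j (V' w * a j w * D j w - V' w * a j w * Y j w) +
    \sum_i (V' w * b w * U i w)) <= _).
  apply: ae_le_Rintegral => //; apply: filterS Xle => w Xw.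
  rewrite addrC expRD mulrA -/(V' w).
  apply: le_trans (ler_wpM2l (V'0 w) Xw) _.
  rewrite !mulrDr mulr1 mulrA -!big_distrr/= mulr_sumr lerD2r lerD2l.
  by rewrite ler_sum// => j _; rewrite mulrA mulrBr.
rewrite RintegralD//; last exact: (integrableD _ iV' isD).
(* The martingale differences integrate to zero by the pull-out property. *)
rewrite RintegralD// eD eU big1 ?addr0; last first.
  move=> j _; have [iD iY _ _] := DY j.
  by rewrite RintegralB ?iVaX// (cond_exp_bounded_mul (DY j) (gVa j) (VaC j)) subrr.
have icst : P.-integrable setT (EFin \o (cst s : T -> R)).
  exact: (finite_measure_integrable_cst P s).
apply: le_trans (_ : \int[P]_w V' w + \sum_(i in I) \int[P]_w (V' w * b w * s) <= _).
  rewrite lerD2l; apply: ler_sum => i _.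
  exact: (cond_exp_bounded_mul_le (UZ i) (Zs i) gVb Vb0 VbC).
have iVbs : P.-integrable setT (EFin \o (fun w => V' w * b w * s)).
  exact: (iVbX _ icst).
have inVbs : P.-integrable setT
    (EFin \o (fun w => #|I|%:R * (V' w * b w * s))).
  exact: (integrableZl _ _ iVbs).
rewrite sumr_const -[_ *+ _]mulr_natl -(RintegralZl _ measurableT iVbs).
rewrite -(RintegralD measurableT iV' inVbs) -(RintegralZl _ measurableT iV).
apply: ae_le_Rintegral.
- exact: (integrableD _ iV' inVbs).
- exact: (integrableZl _ _ iV).
- apply: filterS bq => w bqw.
  (* Here 1 + |I| s b <= 1 + q + v <= exp(q + v), and the factor exp(-q) inside [V'] cancels
     exp(q). *)
  apply: le_trans (_ : V' w * (1 + #|I|%:R * s * b w) <= _).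
    by rewrite le_eqVlt; apply/orP; left; apply/eqP; ring.
  apply: le_trans (_ : V' w * expR (q w + v) <= _).
    by rewrite ler_wpM2l// (le_trans _ (expR_ge1Dx _))// lerD2l.
  by rewrite /V' -mulrA -expRD addKr mulrC.
Qed.

End ConditionalExpectation.

(** * One clipped step *)

Section Clipping.
Variables (R : realType) (d : nat) (lam p : R).
Hypotheses (lam0 : 0 < lam) (p12 : 1 < p <= 2).
Implicit Types (g c : 'rV[R]_d).

Lemma clip_small g : enorm g <= lam -> clip lam g = g.
Proof.
move=> glam; have [/enorm_eq0->|g0] := eqVneq (enorm g) 0.
  by rewrite /clip scaler0.
rewrite /clip min_l ?scale1r// ler_pdivlMr ?mul1r//.
by rewrite lt_neqAle eq_sym g0 enorm_ge0.
Qed.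

Lemma clip_large g : lam < enorm g -> clip lam g = (lam / enorm g) *: g.
Proof.
move=> glam; rewrite /clip min_r// ler_pdivrMr ?mul1r ?ltW//.
exact: lt_trans glam.
Qed.

Lemma enorm_clip g : enorm (clip lam g) <= lam.
Proof.
have [glam|glam] := leP (enorm g) lam; first by rewrite clip_small.
have g0 : 0 < enorm g by exact: lt_trans glam.
rewrite clip_large// enormZ gtr0_norm ?divr_gt0//.
by rewrite divfK// gt_eqF.
Qed.

Variable c : 'rV[R]_d.
Hypothesis c_small : 2 * enorm c <= lam.

(** A clipped [g] lies outside the ball of radius [lam] while [c] lies within half that radius, so
    the noise is at least lam / 2. *)
Lemma clip_error_large g : lam < enorm g -> lam <= 2 * enorm (g - c).
Proof.
move=> glam; have := enormD (g - c) c; rewrite subrK.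
have := c_small; lra.
Qed.

Lemma clip_error_bounded g : enorm (clip lam g - c) <= 2 * lam.
Proof.
have := enormD (clip lam g) (- c); have := enorm_clip g.
by have := c_small; have := lam0; rewrite enormN; lra.
Qed.

(** The bias vanishes unless |g| > lam. Then it equals |g| - lam, which is at most n = |g - c|, and
    n >= lam / 2 allows the extra factor (2 n / lam)^(p-1) >= 1. *)
Lemma clip_bias g :
  enorm (clip lam g - g) <= (2 / lam) `^ (p - 1) * enorm (g - c) `^ p.
Proof.
have [p1 p2] := andP p12.
have [glam|glam] := leP (enorm g) lam.
  by rewrite clip_small// subrr enorm0 mulr_ge0 ?powR_ge0.
have g0 : 0 < enorm g by exact: lt_trans glam.
have nlam := clip_error_large glam; set n := enorm (g - c) in nlam *.
apply: le_trans (_ : n <= _).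
  rewrite clip_large// -[X in _ - X]scale1r -scalerBl enormZ distrC.
  rewrite ger0_norm ?subr_ge0; last by rewrite ler_pdivrMr// mul1r ltW.
  rewrite mulrBl mul1r divfK ?gt_eqF//.
  by have := enormD (g - c) c; have := c_small; have := lam0; rewrite subrK -/n; lra.
have n0 : 0 <= n by exact: enorm_ge0.
rewrite -(mulr_powRB1 n0); last by lra.
rewrite mulrCA -powRM ?divr_ge0 ?(ltW lam0)// -[leLHS]mulr1 ler_wpM2l//.
apply: le_trans (_ : 1 `^ (p - 1) <= _); first by rewrite powR1.
apply: ge0_ler_powR; rewrite ?nnegrE//.
- by lra.
- by rewrite mulr_ge0// divr_ge0// ltW.
- by rewrite mulrAC ler_pdivlMr// mul1r.
Qed.

(** Interpolation: the clipped error is at most 4 |g - c| and at most 2 lam; its square is split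
    into a p-th power, bounded by the former, and a (2-p)-th power, bounded by the latter. *)
Lemma clip_error_sqr g : enorm (clip lam g - c) ^+ 2 <=
  4 `^ p * 2 `^ (2 - p) * lam `^ (2 - p) * enorm (g - c) `^ p.
Proof.
have [p1 p2] := andP p12.
set z := enorm _; set n := enorm (g - c).
have z0 : 0 <= z by exact: enorm_ge0.
have n0 : 0 <= n by exact: enorm_ge0.
have zn : z <= 4 * n.
  have [glam|glam] := leP (enorm g) lam.
    by rewrite /z clip_small// -/n; lra.
  by have := clip_error_large glam; have := clip_error_bounded g; rewrite -/z -/n; lra.
have -> : z ^+ 2 = z `^ p * z `^ (2 - p).
  rewrite -powRD ?subrKC ?powR_mulrn//.
  by apply/implyP; rewrite pnatr_eq0.
apply: le_trans (_ : (4 * n) `^ p * (2 * lam) `^ (2 - p) <= _).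
  rewrite ler_pM ?powR_ge0//; apply: ge0_ler_powR; rewrite ?nnegrE//.
  - by lra.
  - by rewrite mulr_ge0.
  - by lra.
  - by rewrite mulr_ge0// ltW.
  - exact: clip_error_bounded.
by rewrite powRM// powRM ?(ltW lam0)//; lra.
Qed.

End Clipping.

Lemma sum_ord_const (R : pzSemiRingType) (N : nat) (c : R) :
  \sum_(i < N) c = N%:R * c.
Proof. by rewrite sumr_const card_ord mulr_natl. Qed.

Lemma sqr_sum_le (R : realType) (N : nat) (u : 'I_N -> R) :
  (\sum_i u i) ^+ 2 <= N%:R * \sum_i u i ^+ 2.
Proof.
have := dot_abs_le (const_mx 1 : 'rV[R]_N) (\row_i u i).
have -> : dot (const_mx 1) (\row_i u i) = \sum_i u i.
  by apply: eq_bigr => i _; rewrite !mxE mul1r.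
rewrite -ler_sqr ?nnegrE ?mulr_ge0 ?enorm_ge0// real_normK ?num_real// exprMn.
rewrite !enorm_sqr /dot.
under [X in _ <= X * _]eq_bigr do rewrite !mxE mulr1.
under [X in _ <= _ * X]eq_bigr do rewrite !mxE -expr2.
by rewrite sumr_const card_ord.
Qed.

(** From exp(-x) >= 1 - x comes exp(x) <= 1 + x exp(x). The last term is x + x (exp(x) - 1), where
    exp(x) - 1 is bounded by the same inequality if x >= 0 and from below by x if x < 0. *)
Lemma expR_le_quadratic (R : realType) (x C : R) : `|x| <= C ->
  expR x <= 1 + x + expR C * x ^+ 2.
Proof.
rewrite ler_norml => /andP[Cx xC].
have h1 : expR x <= 1 + x * expR x.
  have := expR_ge1Dx (- x); rewrite expRN => h.
  by have := expR_gt0 x => e0; have := ler_wpM2l (ltW e0) h; rewrite divff ?gt_eqF//; lra.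
have C1 : 1 <= expR C by rewrite -expR0 ler_expR; lra.
have xC' : expR x <= expR C by rewrite ler_expR.
have h0 := expR_ge1Dx x.
have [x0|x0] := leP 0 x; nra.
Qed.

Section Step.
Variables (R : realType) (d N : nat) (eta lam H M C1 p : R).
Hypotheses (N0 : (0 < N)%N) (eta0 : 0 <= eta) (lam0 : 0 < lam) (H0 : 0 <= H)
  (M0 : 0 <= M) (etalam : eta * lam <= C1) (p12 : 1 < p <= 2).
Variables (h : 'rV[R]_d) (c g : 'I_N -> 'rV[R]_d).
Hypotheses (h_le : enorm h <= H) (c_le : forall i, 2 * enorm (c i) <= lam).

Let G i := clip lam (g i).
Let N0' : 0 < N%:R :> R. Proof. by rewrite ltr0n. Qed.
Let etaN0 : 0 <= eta / N%:R. Proof. by rewrite divr_ge0. Qed.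

(** Here [h] stands for the gradient of f_t at the mean state, [c i] for the true local gradients
    and [g i] for their estimators. [step_lin] and [step_sqr] carry the first- and second-order
    effects of the clipped noise on the descent, and [step_dev] is the deviation X_t. *)
Definition step_lin : R := - (eta / N%:R) * \sum_i dot h (clip lam (g i) - c i).
Definition step_sqr : R := eta ^+ 2 / N%:R * \sum_i enorm (clip lam (g i) - c i) ^+ 2.
Definition step_dev : R := step_lin + 2 * M * step_sqr.

Definition step_dev_max : R := 2 * H * C1 + 8 * M * C1 ^+ 2.
(** The summand 2 M comes from [step_dev] itself, the rest from its square: 2 H^2 through
    [step_lin_sqr] and 32 M^2 C1^2 through [step_sqr_le]. *)
Definition step_exp_coef : R :=
  2 * M + expR step_dev_max * (2 * H ^+ 2 + 32 * M ^+ 2 * C1 ^+ 2).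

Let C1_ge0 : 0 <= C1.
Proof. by apply: le_trans etalam; rewrite mulr_ge0// ltW. Qed.

Lemma step_sqr_ge0 : 0 <= step_sqr.
Proof.
by rewrite mulr_ge0 ?divr_ge0 ?sqr_ge0// sumr_ge0// => i _; rewrite sqr_ge0.
Qed.

Lemma step_sqr_le : step_sqr <= 4 * C1 ^+ 2.
Proof.
apply: le_trans (_ : eta ^+ 2 / N%:R * \sum_(i < N) (2 * lam) ^+ 2 <= _).
  rewrite ler_wpM2l ?divr_ge0 ?sqr_ge0//; apply: ler_sum => i _.
  rewrite ler_sqr ?nnegrE ?enorm_ge0 ?mulr_ge0 ?(ltW lam0)//.
  exact: clip_error_bounded.
rewrite sum_ord_const.
have -> : eta ^+ 2 / N%:R * (N%:R * (2 * lam) ^+ 2) = 4 * (eta * lam) ^+ 2.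
  by field; rewrite gt_eqF.
by rewrite ler_wpM2l// ler_sqr ?nnegrE ?mulr_ge0// ltW.
Qed.

Lemma step_lin_abs : `|step_lin| <= 2 * H * C1.
Proof.
rewrite normrM normrN (ger0_norm etaN0).
apply: le_trans (_ : eta / N%:R * \sum_(i < N) (H * (2 * lam)) <= _).
  rewrite ler_wpM2l//; apply: le_trans (ler_norm_sum _ _ _) _.
  apply: ler_sum => i _; apply: le_trans (dot_abs_le _ _) _.
  by rewrite ler_pM ?enorm_ge0// clip_error_bounded.
rewrite sum_ord_const.
have -> : eta / N%:R * (N%:R * (H * (2 * lam))) = 2 * H * (eta * lam).
  by field; rewrite gt_eqF.
by rewrite ler_wpM2l// mulr_ge0.
Qed.

(** Turns the squared first-order part into second-order terms, so that the square of the deviation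
    becomes linear in the squared clipped errors. *)
Lemma step_lin_sqr : step_lin ^+ 2 <= H ^+ 2 * step_sqr.
Proof.
rewrite exprMn sqrrN.
apply: le_trans (_ : (eta / N%:R) ^+ 2 *
    (N%:R * \sum_i (H * enorm (clip lam (g i) - c i)) ^+ 2) <= _).
  rewrite ler_wpM2l ?sqr_ge0//; apply: le_trans (sqr_sum_le _) _.
  rewrite ler_wpM2l//; apply: ler_sum => i _.
  rewrite -[leLHS]real_normK ?num_real// ler_sqr ?nnegrE ?mulr_ge0 ?enorm_ge0//.
  by apply: le_trans (dot_abs_le _ _) _; rewrite ler_wpM2r ?enorm_ge0.
under eq_bigr do rewrite exprMn.
rewrite -mulr_sumr /step_sqr le_eqVlt; apply/orP; left; apply/eqP.
by field; rewrite gt_eqF.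
Qed.

Lemma step_dev_abs : `|step_dev| <= step_dev_max.
Proof.
apply: le_trans (ler_normD _ _) _; apply: lerD; first exact: step_lin_abs.
rewrite ger0_norm; last by apply: mulr_ge0 step_sqr_ge0; exact: mulr_ge0.
have := ler_wpM2l M0 step_sqr_le; nra.
Qed.

Lemma expR_step_dev_quadratic :
  expR step_dev <= 1 + step_lin + step_exp_coef * step_sqr.
Proof.
have e0 := expR_gt0 step_dev_max.
apply: le_trans (expR_le_quadratic step_dev_abs) _.
have hl := step_lin_sqr; have hs := step_sqr_le; have hs0 := step_sqr_ge0.
have h2 : (2 * M * step_sqr) ^+ 2 <= 16 * M ^+ 2 * C1 ^+ 2 * step_sqr.
  have := ler_wpM2l (mulr_ge0 (sqr_ge0 M) hs0) hs; lra.
have key : step_dev ^+ 2 <= (2 * H ^+ 2 + 32 * M ^+ 2 * C1 ^+ 2) * step_sqr.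
  have := sqr_ge0 (step_lin - 2 * M * step_sqr); rewrite /step_dev; lra.
have := ler_wpM2l (ltW e0) key; rewrite /step_exp_coef {2}/step_dev; lra.
Qed.

(** The first summand is the price of the clipping bias, the second that of the squared clipped
    error. *)
Definition moment_coef : R := (eta / N%:R) * enorm h * (2 / lam) `^ (p - 1) +
  step_exp_coef * (eta ^+ 2 / N%:R) * (4 `^ p * 2 `^ (2 - p) * lam `^ (2 - p)).

Lemma step_exp_coef_ge0 : 0 <= step_exp_coef.
Proof.
apply: addr_ge0; first exact: mulr_ge0.
apply: mulr_ge0; first exact: expR_ge0.
apply: addr_ge0; apply: mulr_ge0; rewrite ?sqr_ge0//.
by apply: mulr_ge0; rewrite ?sqr_ge0.
Qed.

Lemma moment_coef_ge0 : 0 <= moment_coef.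
Proof.
apply: addr_ge0; first by rewrite !mulr_ge0 ?enorm_ge0 ?powR_ge0.
apply: mulr_ge0; last by rewrite !mulr_ge0 ?powR_ge0.
by apply: mulr_ge0; [exact: step_exp_coef_ge0|rewrite divr_ge0// sqr_ge0].
Qed.

(** In the linear part the clipped estimator is replaced by the unclipped one at the cost of
    [clip_bias]. What remains is a martingale difference, split by agent and coordinate because
    conditional expectations are taken of real functions. *)
Lemma expR_step_dev :
  expR step_dev <= 1 +
    \sum_(j : 'I_N * 'I_d)
      (- (eta / N%:R) * h 0 j.2) * (g j.1 0 j.2 - c j.1 0 j.2) +
    moment_coef * \sum_i enorm (g i - c i) `^ p.
Proof.
apply: le_trans expR_step_dev_quadratic _.
have coef0 := step_exp_coef_ge0.
set U := \sum_i enorm (g i - c i) `^ p.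
set S := \sum_(j : 'I_N * 'I_d) _.
have quad : step_exp_coef * step_sqr <= step_exp_coef *
    (eta ^+ 2 / N%:R * (4 `^ p * 2 `^ (2 - p) * lam `^ (2 - p) * U)).
  rewrite ler_wpM2l// ler_wpM2l ?divr_ge0 ?sqr_ge0//.
  rewrite mulr_sumr; apply: ler_sum => i _; exact: clip_error_sqr.
have lin : step_lin <= S + eta / N%:R * (enorm h * ((2 / lam) `^ (p - 1) * U)).
  have -> : S = - (eta / N%:R) * \sum_i dot h (g i - c i).
    rewrite /S -(pair_bigA _ (fun i k =>
      - (eta / N%:R) * h 0 k * (g i 0 k - c i 0 k)))/=.
    rewrite mulr_sumr; apply: eq_bigr => i _; rewrite mulr_sumr.
    by apply: eq_bigr => k _; rewrite !mxE mulrA.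
  rewrite /step_lin !mulNr -lerBlDl opprK addrC -mulrBr ler_wpM2l//.
  rewrite -sumrB !mulr_sumr; apply: ler_sum => i _.
  rewrite -dotBr opprB addrA subrK.
  have -> : g i - clip lam (g i) = - (clip lam (g i) - g i) by rewrite opprB.
  apply: le_trans (dot_le _ _) _; rewrite enormN ler_wpM2l ?enorm_ge0//.
  exact: clip_bias.
rewrite /moment_coef; lra.
Qed.

(** The step direction is split as the clipped errors plus [h] plus the consensus error; in the
    quadratic term each clipped gradient is bounded by its error plus [c i]. *)
Lemma descent_step (F : 'rV[R]_d -> R) (xb : 'rV[R]_d) (e Bg : R) :
  (forall z, differentiable F z) ->
  (forall z z', enorm (grad F z - grad F z') <= M * enorm (z - z')) ->
  grad F xb = h -> enorm (\sum_i c i - h) <= e -> 0 <= Bg ->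
  (forall i, enorm (c i) <= Bg) ->
  eta / N%:R * enorm h ^+ 2 <=
    F xb - F (xb - (eta / N%:R) *: \sum_i clip lam (g i)) + step_dev +
    eta / N%:R * H * e + 2 * M * Bg ^+ 2 * eta ^+ 2.
Proof.
move=> dF lipF hF ch Bg0 cBg.
set x' := xb - _; have := smooth_upper_bound xb x' dF lipF.
have -> : x' - xb = - (eta / N%:R) *: \sum_i clip lam (g i).
  by rewrite /x' addrC addKr scaleNr.
rewrite hF dotZr enormZ normrN (ger0_norm etaN0) exprMn => up.
have lin : - (eta / N%:R) * dot h (\sum_i clip lam (g i)) <=
    step_lin - eta / N%:R * enorm h ^+ 2 + eta / N%:R * H * e.
  have -> : dot h (\sum_i clip lam (g i)) =
      \sum_i dot h (clip lam (g i) - c i) + enorm h ^+ 2 +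
      dot h (\sum_i c i - h).
    rewrite -dot_sumr enorm_sqr -!dotDr sumrB; congr (dot h _).
    by rewrite -addrA subrKC subrK.
  have := dot_abs_le h (\sum_i c i - h); rewrite ler_norml => /andP[hd _].
  have : enorm h * enorm (\sum_i c i - h) <= H * e by rewrite ler_pM ?enorm_ge0.
  move: hd; set D := dot h (\sum_i c i - h) => hd hHe.
  have : eta / N%:R * (- D) <= eta / N%:R * (H * e).
    by rewrite ler_wpM2l//; lra.
  rewrite /step_lin; lra.
have quad : M * ((eta / N%:R) ^+ 2 * enorm (\sum_i clip lam (g i)) ^+ 2) <=
    2 * M * step_sqr + 2 * M * Bg ^+ 2 * eta ^+ 2.
  have -> : 2 * M * step_sqr + 2 * M * Bg ^+ 2 * eta ^+ 2 = M * ((eta / N%:R) ^+ 2 *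
     (N%:R * \sum_i (2 * enorm (clip lam (g i) - c i) ^+ 2 + 2 * Bg ^+ 2))).
    rewrite big_split/= -mulr_sumr sum_ord_const /step_sqr.
    by field; rewrite gt_eqF.
  rewrite ler_wpM2l// ler_wpM2l ?sqr_ge0//.
  apply: le_trans (_ : (\sum_i enorm (clip lam (g i))) ^+ 2 <= _).
    by rewrite ler_sqr ?nnegrE ?enorm_ge0 ?sumr_ge0 ?enorm_sum// => i _; rewrite enorm_ge0.
  apply: le_trans (sqr_sum_le _) _; rewrite ler_wpM2l//; apply: ler_sum => i _.
  have := enormD (clip lam (g i) - c i) (c i); rewrite subrK.
  have := cBg i; have := enorm_ge0 (c i); have := enorm_ge0 (clip lam (g i)).
  have := enorm_ge0 (clip lam (g i) - c i).
  set u := enorm (clip lam (g i)); set v := enorm (_ - _); set w := enorm (c i).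
  move=> v0 u0 w0 wB uvw; have := sqr_ge0 (v - w); nra.
rewrite /step_dev; lra.
Qed.

End Step.

(** * Rates *)

Section Rates.
Variables (R : realType) (p Bg a b : R).
Hypotheses (p12 : 1 < p <= 2) (Bg0 : 0 < Bg) (a0 : 0 < a) (b0 : 0 <= b).

Definition rate_kappa : R := (p + 1) / (2 * p).
Definition clip_level (t : nat) : R := 2 * Bg * t%:R `^ (1 / (2 * p)).
Definition step_size (t : nat) : R := 1 / (a * t%:R + b) `^ rate_kappa.

Notation kappa := rate_kappa.
Notation lam := clip_level.
Notation step := step_size.

Let p0 : 0 < p. Proof. by have := p12; lra. Qed.
Let p_neq0 : p != 0. Proof. by rewrite gt_eqF. Qed.

Lemma rate_kappa_gt0 : 0 < kappa.
Proof. by rewrite divr_gt0 ?addr_gt0 ?mulr_gt0. Qed.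

Lemma step_size_ge0 t : 0 <= step t.
Proof. by rewrite divr_ge0// powR_ge0. Qed.

Let base_gt0 t : (0 < t)%N -> 0 < a * t%:R + b.
Proof. by move=> t0; rewrite ltr_wpDr// mulr_gt0// ltr0n. Qed.

Lemma step_size_gt0 t : (0 < t)%N -> 0 < step t.
Proof. by move=> t0; rewrite divr_gt0// powR_gt0// base_gt0. Qed.

Lemma step_size_noninc t u : (1 <= t <= u)%N -> step u <= step t.
Proof.
move=> /andP[t0 tu]; have u0 := leq_trans t0 tu.
rewrite /step !div1r lef_pV2 ?posrE ?powR_gt0 ?base_gt0//.
apply: ge0_ler_powR; rewrite ?nnegrE ?(ltW rate_kappa_gt0) ?(ltW (base_gt0 _))//.
by rewrite lerD2r ler_wpM2l ?(ltW a0)// ler_nat.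
Qed.

(** For t >= 1, a t + b <= (a + b) t. *)
Lemma step_size_inv_le t : (0 < t)%N ->
  (step t)^-1 <= (a + b) `^ kappa * t%:R `^ kappa.
Proof.
move=> t0; rewrite /step div1r invrK -powRM ?addr_ge0 ?(ltW a0)//.
have t1 : (1 : R) <= t%:R by rewrite ler1n.
apply: ge0_ler_powR; rewrite ?nnegrE ?(ltW rate_kappa_gt0) ?(ltW (base_gt0 _))//.
  by rewrite mulr_ge0// addr_ge0// ltW.
by have := b0; nra.
Qed.

Definition rate_const : R := a `^ (- kappa).
Notation A := rate_const.

Lemma rate_const_ge0 : 0 <= A.
Proof. exact: powR_ge0. Qed.

Lemma step_size_le t : (0 < t)%N -> step t <= A * t%:R `^ (- kappa).
Proof.
move=> t0; have t0' : 0 < t%:R :> R by rewrite ltr0n.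
rewrite /step div1r -powRM ?(ltW a0) ?(ltW t0')// powRN.
rewrite lef_pV2 ?posrE ?powR_gt0 ?base_gt0 ?mulr_gt0//.
apply: ge0_ler_powR; rewrite ?nnegrE ?(ltW rate_kappa_gt0) ?(ltW (base_gt0 _))//.
  by rewrite mulr_ge0// ltW.
by rewrite lerDl.
Qed.

Lemma clip_level_ge0 t : 0 <= lam t.
Proof. by rewrite !mulr_ge0 ?powR_ge0// ltW. Qed.

Lemma clip_level_ge t : (0 < t)%N -> 2 * Bg <= lam t.
Proof.
move=> t0; rewrite /lam -[leLHS]mulr1 ler_wpM2l ?mulr_ge0 ?(ltW Bg0)//.
apply: le_trans (_ : t%:R `^ 0 <= _); first by rewrite powRr0.
by apply: ler_powR; rewrite ?ler1n// divr_ge0// mulr_ge0// ltW.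
Qed.

Lemma clip_level_gt0 t : (0 < t)%N -> 0 < lam t.
Proof. by move=> /clip_level_ge; apply: lt_le_trans; rewrite mulr_gt0. Qed.

Let powRDn t (r s : R) : (0 < t)%N -> t%:R `^ r * t%:R `^ s = t%:R `^ (r + s).
Proof. by move=> t0; rewrite powRD//; apply/implyP => _; rewrite pnatr_eq0 -lt0n. Qed.

(** The exponents add up to -kappa + 1/(2p) = -1/2. *)
Lemma step_clip_le t : (0 < t)%N ->
  step t * lam t <= A * (2 * Bg) * t%:R `^ (- 2^-1).
Proof.
move=> t0; apply: le_trans (ler_wpM2r (clip_level_ge0 t) (step_size_le t0)) _.
rewrite /lam mulrACA [t%:R `^ _ * _]powRDn// le_eqVlt; apply/orP; left; apply/eqP.
congr (_ * _ `^ _); rewrite /kappa; field.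
exact: p_neq0.
Qed.

Lemma step_clip_le1 t : (0 < t)%N -> step t * lam t <= A * (2 * Bg).
Proof.
move=> t0; apply: le_trans (step_clip_le t0) _.
have A0 : 0 <= A * (2 * Bg) by rewrite !mulr_ge0 ?rate_const_ge0 ?(ltW Bg0).
rewrite -[leRHS]mulr1 ler_wpM2l//.
apply: le_trans (_ : t%:R `^ 0 <= _); last by rewrite powRr0.
by apply: ler_powR; rewrite ?ler1n// oppr_le0 invr_ge0.
Qed.

Lemma power_rate_sum (F : nat -> R) (c r : R) : 1 < r -> 0 <= c ->
  (forall t, (0 < t)%N -> F t <= c * t%:R `^ (- r)) ->
  exists2 C, 0 <= C & forall T, \sum_(1 <= t < T.+1) F t <= C.
Proof.
move=> r1 c0 Fle; have [C C0 hC] := powR_sum_bounded r1.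
exists (c * C) => [|T]; first exact: mulr_ge0.
apply: le_trans (ler_wpM2l c0 (hC T)); rewrite mulr_sumr big_nat [leRHS]big_nat.
by apply: ler_sum => t /andP[t0 _]; exact: Fle.
Qed.

(** Summable since 2 kappa = 1 + 1/p. *)
Lemma step_sqr_sum : exists2 C, 0 <= C &
  forall T, \sum_(1 <= t < T.+1) step t ^+ 2 <= C.
Proof.
apply: (@power_rate_sum _ (A ^+ 2) (2 * kappa)) => [||t t0].
- rewrite /kappa mulrA ltr_pdivlMr ?mulr_gt0//; lra.
- exact: sqr_ge0.
have -> : - (2 * kappa) = - kappa * 2 by ring.
rewrite powRrM powR_mulrn ?powR_ge0// -exprMn.
rewrite ler_sqr ?nnegrE ?step_size_ge0 ?mulr_ge0 ?rate_const_ge0 ?powR_ge0//.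
exact: step_size_le.
Qed.

Lemma step_step_clip_sum : exists2 C, 0 <= C &
  forall T, \sum_(1 <= t < T.+1) step t * (step t * lam t) <= C.
Proof.
apply: (@power_rate_sum _ (A * (A * (2 * Bg))) (kappa + 2^-1)) => [||t t0].
- have -> : kappa + 2^-1 = 1 + (2 * p)^-1.
    by rewrite /kappa; field; exact: p_neq0.
  by rewrite ltrDl invr_gt0 mulr_gt0.
- by rewrite !mulr_ge0 ?rate_const_ge0 ?(ltW Bg0).
rewrite opprD -powRDn// [leRHS]mulrACA.
apply: ler_pM; first exact: step_size_ge0.
- by apply: mulr_ge0; [exact: step_size_ge0|exact: clip_level_ge0].
- exact: step_size_le.
- exact: step_clip_le.
Qed.

(** The exponent is 1 + (p-1)/(2p). The square is what Young's inequality produces; the unsquared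
    bias would decay like 1/t and cost a logarithm. *)
Lemma step_bias_sum : exists2 C, 0 <= C & forall T,
  \sum_(1 <= t < T.+1) step t * ((2 / lam t) `^ (p - 1)) ^+ 2 <= C.
Proof.
have [p1 p2] := andP p12.
apply: (@power_rate_sum _ (A * (Bg^-1 `^ (p - 1)) ^+ 2) (kappa + (p - 1) / p))
    => [||t t0].
- have -> : kappa + (p - 1) / p = 1 + (p - 1) / (2 * p).
    by rewrite /kappa; field; exact: p_neq0.
  by rewrite ltrDl divr_gt0 ?subr_gt0 ?mulr_gt0.
- by rewrite mulr_ge0 ?rate_const_ge0 ?sqr_ge0.
have -> : 2 / lam t = Bg^-1 * t%:R `^ (- (1 / (2 * p))).
  have tp : t%:R `^ (1 / (2 * p)) != 0 by rewrite gt_eqF// powR_gt0// ltr0n.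
  have Bgn : Bg != 0 by rewrite gt_eqF.
  by rewrite /lam powRN; field; rewrite ?tp ?Bgn.
rewrite powRM ?powR_ge0 ?invr_ge0 ?(ltW Bg0)// exprMn opprD -powRDn// [leRHS]mulrACA.
rewrite -powRrM ler_pM ?step_size_ge0 ?step_size_le//.
  by rewrite mulr_ge0 ?sqr_ge0.
rewrite ler_wpM2l ?sqr_ge0// -powR_mulrn ?powR_ge0// -powRrM.
rewrite le_eqVlt; apply/orP; left; apply/eqP; congr (_ `^ _).
by field; exact: p_neq0.
Qed.

(** The exponent is 2 kappa - (2-p)/(2p) = 3/2, whereas the crude square of step times level would
    decay only like 1/t. *)
Lemma step_variance_sum : exists2 C, 0 <= C & forall T,
  \sum_(1 <= t < T.+1) step t ^+ 2 * lam t `^ (2 - p) <= C.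
Proof.
have [p1 p2] := andP p12.
apply: (@power_rate_sum _ (A ^+ 2 * (2 * Bg) `^ (2 - p)) (3 / 2)) => [||t t0].
- by rewrite ltr_pdivlMr//; lra.
- by rewrite mulr_ge0 ?sqr_ge0 ?powR_ge0.
rewrite /lam powRM ?mulr_ge0 ?powR_ge0 ?(ltW Bg0)//.
have -> : - (3 / 2) = - (kappa * 2) + 1 / (2 * p) * (2 - p).
  by rewrite /kappa; field; exact: p_neq0.
rewrite -powRDn// [leRHS]mulrACA -mulNr -(powRrM t%:R (1 / (2 * p))).
rewrite (powRrM _ (- kappa)) ler_pM ?sqr_ge0//.
  by rewrite mulr_ge0 ?powR_ge0.
rewrite powR_mulrn ?powR_ge0// -exprMn.
rewrite ler_sqr ?nnegrE ?step_size_ge0 ?mulr_ge0 ?rate_const_ge0 ?powR_ge0//.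
exact: step_size_le.
Qed.

End Rates.

(** * Regret of one trajectory *)

(** One factor of z^2 is bounded by the diameter 2 D, so that the error is linear in [s] and only
    the first power of the spread has to be summable. *)
Lemma sqr_perturbed_le (R : realFieldType) (u v w z s D M : R) :
  0 <= u -> 0 <= v -> 0 <= z -> 0 <= M -> 0 <= D ->
  z <= s -> z <= 2 * D -> u <= w + v -> v <= M * z ->
  u ^+ 2 <= 2 * w ^+ 2 + 4 * M ^+ 2 * D * s.
Proof.
move=> u0 v0 z0 M0 D0 zs zD uwv vM.
have u2 : u ^+ 2 <= 2 * w ^+ 2 + 2 * v ^+ 2.
  apply: le_trans (_ : (w + v) ^+ 2 <= _).
    by rewrite ler_sqr ?nnegrE// (le_trans u0).
  by have := sqr_ge0 (w - v); lra.
have v2 : v ^+ 2 <= M ^+ 2 * z ^+ 2.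
  by rewrite -exprMn ler_sqr ?nnegrE ?mulr_ge0.
have z2 : z ^+ 2 <= 2 * D * s by rewrite expr2 ler_pM.
have := ler_wpM2l (sqr_ge0 M) z2; lra.
Qed.

Section Trajectory.
Variables (R : realType) (d N : nat) (p L BX Bg eta : R) (B : nat) (a b : R).
Hypotheses (N0 : (0 < N)%N) (p12 : 1 < p <= 2) (BX0 : 0 < BX) (Bg0 : 0 < Bg)
  (eta01 : 0 < eta < 1) (a0 : 0 < a) (b0 : 0 <= b).

Local Notation step := (step_size p a b).
Local Notation lam := (clip_level p Bg).
Local Notation M := (N%:R * `|L|).
Local Notation H := (N%:R * Bg).

Variables (T : nat) (f : 'I_N -> nat -> 'rV[R]_d -> R)
  (W : nat -> 'M[R]_N) (E : nat -> rel 'I_N) (x g : 'I_N -> nat -> 'rV[R]_d).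
Local Notation F := (total_cost f).
Local Notation xb := (mean_state x).

Hypothesis smooth : smooth_costs L T f.
Hypothesis network : network_assumption eta B W E.
Hypothesis bounded : forall i t, (1 <= t <= T.+1)%N ->
  [/\ enorm (x i t) <= BX, enorm (grad (f i t) (x i t)) <= Bg &
      enorm (grad (f i t) (xb t)) <= Bg].
Hypothesis update : forall i t, (1 <= t <= T)%N ->
  x i t.+1 = \sum_(j < N) W t i j *: x j t - step t *: clip (lam t) (g i t).

Let N0' : 0 < N%:R :> R. Proof. by rewrite ltr0n. Qed.
Let M0 : 0 <= M. Proof. by rewrite mulr_ge0. Qed.

Lemma grad_total_cost t y : (1 <= t <= T.+1)%N ->
  grad (F t) y = \sum_i grad (f i t) y.
Proof. by move=> tT; apply: grad_sum => i; case: (smooth i tT). Qed.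

Lemma total_cost_differentiable t y : (1 <= t <= T.+1)%N ->
  differentiable (F t) y.
Proof.
move=> tT; have -> : F t = \sum_i f i t.
  by apply/funext => z; rewrite fct_sumE.
by apply: differentiable_sum => i; case: (smooth i tT).
Qed.

Lemma cost_lipschitz i t y z : (1 <= t <= T.+1)%N ->
  enorm (grad (f i t) y - grad (f i t) z) <= `|L| * enorm (y - z).
Proof.
move=> tT; have [_ lip] := smooth i tT; apply: le_trans (lip y z) _.
by rewrite ler_wpM2r ?enorm_ge0// ler_norm.
Qed.

Lemma total_cost_lipschitz t y z : (1 <= t <= T.+1)%N ->
  enorm (grad (F t) y - grad (F t) z) <= M * enorm (y - z).
Proof.
move=> tT; rewrite !grad_total_cost// -sumrB; apply: le_trans (enorm_sum _ _) _.
rewrite -mulrA -sum_ord_const; apply: ler_sum => i _; exact: cost_lipschitz.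
Qed.

Lemma mean_update t : (1 <= t <= T)%N ->
  xb t.+1 = xb t - (step t / N%:R) *: \sum_i clip (lam t) (g i t).
Proof.
move=> /[dup] tT /andP[t1 _]; rewrite /mean_state.
rewrite (eq_bigr _ (fun i _ => update i tT)) sumrB scalerBr; congr (_ - _).
  congr (_ *: _); rewrite exchange_big/=; apply: eq_bigr => j _.
  case: network => _ /(_ t t1)[_ _ colsum] _.
  by rewrite -scaler_suml colsum scale1r.
by rewrite -scaler_sumr scalerA mulrC.
Qed.

Definition spread t := \sum_(k < d) osc (fun i => x i t 0 k).

Lemma state_mean_dist i t : enorm (x i t - xb t) <= spread t.
Proof.
apply: le_trans (enorm_le_sum _) _; apply: ler_sum => k _.
have -> : (x i t - xb t) 0 k = N%:R^-1 * \sum_j (x i t 0 k - x j t 0 k).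
  rewrite !mxE summxE sumrB sum_ord_const mulrBr mulrA mulVf ?mul1r//.
  by rewrite gt_eqF.
rewrite normrM ger0_norm ?invr_ge0// ler_pdivrMl// -sum_ord_const.
apply: le_trans (ler_norm_sum _ _ _) _; apply: ler_sum => j _.
by rewrite ler_norml lerNl opprB !(osc_ub (fun i => x i t 0 k)).
Qed.

Lemma mean_bounded t : (1 <= t <= T.+1)%N -> enorm (xb t) <= BX.
Proof.
move=> tT; rewrite /mean_state enormZ ger0_norm ?invr_ge0// ler_pdivrMl//.
apply: le_trans (enorm_sum _ _) _; rewrite -sum_ord_const.
by apply: ler_sum => i _; case: (bounded i tT).
Qed.

Lemma mean_grad_bounded t : (1 <= t <= T.+1)%N -> enorm (grad (F t) (xb t)) <= H.
Proof.
move=> tT; rewrite grad_total_cost//; apply: le_trans (enorm_sum _ _) _.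
by rewrite -sum_ord_const; apply: ler_sum => i _; case: (bounded i tT).
Qed.

(** The bound of [weighted_contraction_sum] for each of the [d] coordinates, with window N B,
    contraction factor 1 - eta^(N B) and oscillation at most 2 BX. *)
Definition spread_total (C : R) : R :=
  d%:R * ((eta ^+ (N * B))^-1 *
    ((N * B)%:R * (step 1%N * (2 * BX)) + 2 * (N * B)%:R * C)).

Lemma spread_sum (C : R) :
  (forall T', \sum_(1 <= t < T'.+1) step t * (step t * lam t) <= C) ->
  \sum_(1 <= t < T.+1) step t * spread t <= spread_total C.
Proof.
move=> hC; rewrite /spread /spread_total.
under eq_bigr do rewrite mulr_sumr.
rewrite exchange_big/= -sum_ord_const; apply: ler_sum => k _.
have [eta0 eta1] := andP eta01.
have etam0 : 0 < eta ^+ (N * B) by exact: exprn_gt0.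
have step0 t : 0 <= step t by exact: step_size_ge0.
have lam0 t : 0 <= lam t by exact: clip_level_ge0.
apply: le_trans (@weighted_contraction_sum R (N * B) T (1 - eta ^+ (N * B)) (2 * BX)
  step (fun t => osc (fun i => x i t 0 k)) (fun t => step t * lam t) _ _ _ _ _ _ _ _) _.
- by rewrite subr_ge0 exprn_ile1 ?(ltW eta0) ?(ltW eta1)//= gtrBl.
- by rewrite mulr_ge0// ltW.
- by [].
- by move=> t; rewrite mulr_ge0.
- by move=> t; exact: osc_ge0.
- by move=> t u; exact: step_size_noninc.
- move=> t /andP[t1 tT]; have tT' : (1 <= t <= T.+1)%N by rewrite t1 leqW.
  apply: osc_le => [|i j]; first by rewrite mulr_ge0// ltW.
  have [xi _ _] := bounded i tT'; have [xj _ _] := bounded j tT'.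
  have := coord_le_enorm (x i t) k; have := coord_le_enorm (x j t) k.
  rewrite !ler_norml => /andP[h1 h2] /andP[h3 h4]; lra.
- move=> t t1 tT; apply: (@osc_contract _ _ _ _ _ _ eta01 network t t1 T
    (fun t => step t * lam t) (fun t i => x i t 0 k)); last exact: leqW.
  move=> s i sT; have -> : x i s.+1 0 k - \sum_j W s i j * x j s 0 k =
      - (step s * clip (lam s) (g i s) 0 k).
    rewrite update//; move: (clip _ _) => c; rewrite !mxE summxE.
    by under eq_bigr do rewrite mxE; rewrite addrAC subrr add0r.
  rewrite normrN normrM ger0_norm// ler_wpM2l//.
  apply: le_trans (coord_le_enorm _ _) _; apply: enorm_clip.
  by apply: clip_level_gt0 => //; case/andP: sT.
rewrite subKr ler_wpM2l ?invr_ge0 ?(ltW etam0)// lerD2l ler_wpM2l ?mulr_ge0//.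
Qed.

Variable dl : nat -> R.
Hypothesis variation : forall t y, (2 <= t <= T)%N ->
  `|F t y - F t.-1 y| <= dl t.
Local Notation D := (\sum_(2 <= t < T.+1) dl t).

Lemma total_cost_drift t y : (1 <= t <= T)%N ->
  F 1%N y - F t y <= \sum_(2 <= s < t.+1) dl s.
Proof.
elim: t => // t IH; case: t IH => [_ _|t IH tT].
  by rewrite subrr big_geq.
rewrite big_nat_recr//=.
have := @variation t.+2 y tT; rewrite ler_norml => /andP[h _].
have := IH (ltnW tT); rewrite /= in h; lra.
Qed.

(** Each change of cost function costs one term of the variation. The remaining f_1(first mean) -
    f_T(last mean) is bounded by returning to f_1, which costs the variation a second time, and by
    smoothness of f_1 between two points of the ball of radius [BX]. *)
Lemma telescoped_cost : (1 <= T)%N ->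
  \sum_(1 <= t < T.+1) (F t (xb t) - F t (xb t.+1)) <=
    (H + 2 * M * BX) * (2 * BX) + M * (2 * BX) ^+ 2 + 2 * D.
Proof.
move=> T1.
have h t : (1 <= t <= T)%N ->
    \sum_(1 <= s < t.+1) (F s (xb s) - F s (xb s.+1)) <=
      F 1%N (xb 1%N) - F t (xb t.+1) + \sum_(2 <= s < t.+1) dl s.
  elim: t => // t IH; case: t IH => [_ _|t IH tT].
    by rewrite big_nat1 big_geq// addr0.
  rewrite big_nat_recr//= [X in _ <= _ + X]big_nat_recr//=.
  have := @variation t.+2 (xb t.+2) tT; rewrite ler_norml => /andP[_ hv].
  have := IH (ltnW tT); rewrite /= in hv; lra.
have T1T : (1 <= 1 <= T.+1)%N by [].
have hT : (1 <= T <= T)%N by rewrite T1 leqnn.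
have := h T hT; have := total_cost_drift (xb T.+1) hT.
have TT : (1 <= T.+1 <= T.+1)%N by rewrite leqnn.
have bT := mean_bounded TT; have b1 := mean_bounded T1T.
have dist : enorm (xb 1%N - xb T.+1) <= 2 * BX.
  apply: le_trans (enormD _ _) _; rewrite enormN; lra.
(* The gradient of f_1 is bounded by assumption only at the first mean state; the Lipschitz bound
   transports this over a distance 2 BX. *)
have gradT : enorm (grad (F 1%N) (xb T.+1)) <= H + 2 * M * BX.
  apply: le_trans (enorm_le_dist _ (grad (F 1%N) (xb 1%N))) _.
  apply: lerD; first exact: mean_grad_bounded.
  apply: le_trans (total_cost_lipschitz _ _ T1T) _; rewrite enormB.
  have -> : 2 * M * BX = M * (2 * BX) by ring.
  by rewrite ler_wpM2l.
have := smooth_upper_bound (xb T.+1) (xb 1%N)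
  (fun z => total_cost_differentiable z T1T)
  (fun z z' => total_cost_lipschitz z z' T1T).
have : dot (grad (F 1%N) (xb T.+1)) (xb 1%N - xb T.+1) <= (H + 2 * M * BX) * (2 * BX).
  by apply: le_trans (dot_le _ _) _; rewrite ler_pM ?enorm_ge0.
have : M * enorm (xb 1%N - xb T.+1) ^+ 2 <= M * (2 * BX) ^+ 2.
  by rewrite ler_wpM2l// ler_sqr ?nnegrE ?enorm_ge0// mulr_ge0// ltW.
lra.
Qed.

Local Notation h t := (grad (F t) (xb t)).
Local Notation dev t := (step_dev (step t) (lam t) M (h t)
  (fun i => grad (f i t) (x i t)) (fun i => g i t)).

Definition drift_term (t : nat) : R := step t / (2 * N%:R) * enorm (h t) ^+ 2.

(** The left-hand side of [descent_step] is twice the drift; one copy is kept and the other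
    compensates the deviation. *)
Lemma drift_step t : (1 <= t <= T)%N ->
  drift_term t <= F t (xb t) - F t (xb t.+1) + (dev t - drift_term t) +
    H * `|L| * (step t * spread t) + 2 * M * Bg ^+ 2 * step t ^+ 2.
Proof.
move=> tT; have tT' : (1 <= t <= T.+1)%N by case/andP: tT => -> /leqW.
have t0 : (0 < t)%N by case/andP: tT.
have grad_err : enorm (\sum_i grad (f i t) (x i t) - h t) <= M * spread t.
  rewrite grad_total_cost// -sumrB; apply: le_trans (enorm_sum _ _) _.
  rewrite -mulrA -sum_ord_const; apply: ler_sum => i _.
  apply: le_trans (cost_lipschitz _ _ _ tT') _.
  by rewrite ler_wpM2l// state_mean_dist.
have := @descent_step R d N (step t) (lam t) H M N0
  (step_size_ge0 _ _ _ _) M0 (h t) (fun i => grad (f i t) (x i t)) (fun i => g i t)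
  (mean_grad_bounded tT') (F t) (xb t) (M * spread t) Bg
  (fun z => total_cost_differentiable z tT')
  (fun z z' => total_cost_lipschitz z z' tT') erefl grad_err (ltW Bg0).
rewrite -mean_update// => /(_ (fun i => let: And3 _ h _ := bounded i tT' in h)).
have -> : step t / N%:R * H * (M * spread t) = H * `|L| * (step t * spread t).
  by field; rewrite gt_eqF.
have -> : step t / N%:R * enorm (h t) ^+ 2 = 2 * drift_term t.
  by rewrite /drift_term; field; rewrite gt_eqF.
lra.
Qed.

Lemma weighted_regret_step t : (1 <= t <= T)%N ->
  step t * \sum_i enorm (grad (F t) (x i t)) ^+ 2 <=
    4 * N%:R ^+ 2 * drift_term t + 4 * N%:R * M ^+ 2 * BX * (step t * spread t).
Proof.
move=> tT; have tT' : (1 <= t <= T.+1)%N by case/andP: tT => -> /leqW.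
have -> : 4 * N%:R ^+ 2 * drift_term t + 4 * N%:R * M ^+ 2 * BX * (step t * spread t) =
    step t * (N%:R * (2 * enorm (h t) ^+ 2 + 4 * M ^+ 2 * BX * spread t)).
  by rewrite /drift_term; field; rewrite gt_eqF.
rewrite ler_wpM2l ?step_size_ge0// -sum_ord_const; apply: ler_sum => i _.
have [xi _ _] := bounded i tT'; have xbt := mean_bounded tT'.
have xd : enorm (x i t - xb t) <= 2 * BX.
  apply: le_trans (enormD _ _) _; rewrite enormN; lra.
apply: (sqr_perturbed_le (v := enorm (grad (F t) (x i t) - h t))
  (z := enorm (x i t - xb t))); rewrite ?enorm_ge0// ?(ltW BX0)//.
- exact: state_mean_dist.
- exact: enorm_le_dist.
- exact: total_cost_lipschitz.
Qed.

(** Steps are nonincreasing, so the last one bounds all weights from below and factors out of the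
    regret. *)
Lemma weighted_regret_bound (Cs Cc Z : R) : (1 <= T)%N ->
  (forall T', \sum_(1 <= t < T'.+1) step t ^+ 2 <= Cs) ->
  (forall T', \sum_(1 <= t < T'.+1) step t * (step t * lam t) <= Cc) ->
  \sum_(1 <= t < T.+1) (dev t - drift_term t) <= Z ->
  step T * nreg f x T <= 4 * N%:R ^+ 2 *
    ((H + 2 * M * BX) * (2 * BX) + M * (2 * BX) ^+ 2 + 2 * D + Z +
     H * `|L| * spread_total Cc + 2 * M * Bg ^+ 2 * Cs) + 4 * N%:R * M ^+ 2 * BX * spread_total Cc.
Proof.
move=> T1 hCs hCc hZ; have hCo := spread_sum hCc.
apply: le_trans (_ : \sum_(1 <= t < T.+1)
    (4 * N%:R ^+ 2 * drift_term t + 4 * N%:R * M ^+ 2 * BX * (step t * spread t)) <= _).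
  rewrite /nreg mulr_sumr big_nat [leRHS]big_nat; apply: ler_sum => t /andP[t1 tT].
  have tT' : (1 <= t <= T)%N by rewrite t1.
  apply: le_trans (weighted_regret_step tT').
  rewrite ler_wpM2r ?step_size_noninc//.
  by apply: sumr_ge0 => i _; exact: sqr_ge0.
rewrite big_split/= -!mulr_sumr.
apply: lerD; last first.
  by rewrite ler_wpM2l// !mulr_ge0 ?sqr_ge0// ltW.
rewrite ler_wpM2l ?mulr_ge0 ?sqr_ge0//.
apply: le_trans (_ : \sum_(1 <= t < T.+1)
   (F t (xb t) - F t (xb t.+1) + (dev t - drift_term t) +
    H * `|L| * (step t * spread t) + 2 * M * Bg ^+ 2 * step t ^+ 2) <= _).
  rewrite big_nat [leRHS]big_nat; apply: ler_sum => t /andP[t1 tT].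
  by apply: drift_step; rewrite t1.
rewrite 3!big_split/= -!mulr_sumr.
apply: lerD; last by rewrite ler_wpM2l// mulr_ge0 ?sqr_ge0// mulr_ge0.
apply: lerD; last by rewrite ler_wpM2l// !mulr_ge0// ltW.
apply: lerD => //; exact: (telescoped_cost T1).
Qed.

End Trajectory.

(** * The exponential supermartingale *)

Lemma gmeasurable_mono (R : realType) (disp : measure_display)
    (Om : measurableType disp) (G G' : set (set Om)) (V : Om -> R) :
  G `<=` G' -> measurable_fun setT (V : g_sigma_algebraType G -> R) ->
  measurable_fun setT (V : g_sigma_algebraType G' -> R).
Proof.
by move=> GG' mV _ A mA; apply: (sub_sigma_algebra2 GG'); exact: mV.
Qed.

Lemma measurable_step_dev (disp : measure_display) (Om : measurableType disp)
    (R : realType) (d N : nat) (eta lam M : R) (h : Om -> 'rV[R]_d)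
    (c g : 'I_N -> Om -> 'rV[R]_d) :
  vmeasurable h -> (forall i, vmeasurable (c i)) -> (forall i, vmeasurable (g i)) ->
  measurable_fun setT
    (fun w => step_dev eta lam M (h w) (fun i => c i w) (fun i => g i w)).
Proof.
move=> mh mc mg.
have mG i : vmeasurable (fun w => clip lam (g i w) - c i w).
  by apply: vmeasurableB => //; exact: vmeasurable_clip.
apply: measurable_funD.
  apply: measurable_funM => //; apply: measurable_sum => i.
  exact: measurable_dot.
apply: measurable_funM => //; apply: measurable_funM => //.
apply: measurable_sum => i; apply: measurable_funX; exact: measurable_enorm.
Qed.

Section Supermartingale.
Variables (R : realType) (d N : nat) (sigma p L BX Bg : R) (a b : R).
Hypotheses (N0 : (0 < N)%N) (p12 : 1 < p <= 2) (Bg0 : 0 < Bg)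
  (a0 : 0 < a) (b0 : 0 <= b).
Variables (T : nat) (disp : measure_display) (Om : measurableType disp)
  (P : probability Om R).
Variables (f : 'I_N -> nat -> 'rV[R]_d -> R) (W : nat -> 'M[R]_N)
  (g : 'I_N -> nat -> 'rV[R]_d -> Om -> 'rV[R]_d) (x1 : 'I_N -> 'rV[R]_d)
  (x : 'I_N -> nat -> Om -> 'rV[R]_d).

Local Notation step := (step_size p a b).
Local Notation lam := (clip_level p Bg).
Local Notation M := (N%:R * `|L|).
Local Notation H := (N%:R * Bg).
Local Notation C1 := (rate_const p a * (2 * Bg)).
Local Notation xs w := (fun i t => x i t w).
Local Notation est i t := (fun w => g i t (x i t w) w).
Local Notation hist t := (g_sigma_algebraType (history g x t)).

Hypothesis unbiased : unbiased_gradients P T f g x.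
Hypothesis noise : heavy_tailed_noise P T p sigma f g x.
Hypothesis smooth : smooth_costs L T f.
Hypothesis bounded : bounded_iterates P T BX Bg f x.
Hypothesis algo : odcsgd T lam step W x1 g x.

Lemma history_mono s t : (s <= t)%N -> history g x s `<=` history g x t.
Proof.
move=> st A [i [r [k [U [/andP[r1 rs] mU ->]]]]]; exists i, r, k, U; split=> //.
by rewrite r1 (leq_trans rs st).
Qed.

Lemma estimator_measurable i t k : (1 <= t <= T)%N ->
  measurable_fun setT (fun w => est i t w 0 k).
Proof.
by move=> tT; have [_ /(_ k)[+ _ _ _]] := unbiased i tT; exact: integrable_measurable.
Qed.

Lemma history_measurable t : (t <= T.+1)%N -> history g x t `<=` measurable.
Proof.
move=> tT A [i [r [k [U [/andP[r1 rs] mU ->]]]]].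
rewrite -[X in measurable X]setTI; apply: estimator_measurable => //.
by rewrite r1 -ltnS (leq_trans rs tT).
Qed.

Lemma estimator_adapted i s t : (1 <= s < t)%N ->
  vmeasurable (T := hist t) (est i s).
Proof.
move=> st k _ U mU; rewrite setTI; apply: sub_sigma_algebra.
by exists i, s, k, U.
Qed.

(** By induction on the recursion: the initial states are deterministic, and each update uses only
    estimators that enter the next history. *)
Lemma state_adapted t : (1 <= t <= T.+1)%N ->
  forall i, vmeasurable (T := hist t) (x i t).
Proof.
elim: t => // t IH /andP[_ tT] i; have [init upd] := algo.
case: t IH tT => [_ _|t IH tT].
  by move=> k; under eq_fun do rewrite init; exact: measurable_cst.
have tT' : (1 <= t.+1 <= T)%N by [].
move=> k; under eq_fun do rewrite upd//; move: k.
have mx j : vmeasurable (T := hist t.+2) (x j t.+1).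
  move=> k; apply: gmeasurable_mono (history_mono (leqnSn _)) _.
  by apply: IH; rewrite /= ltnW.
apply: vmeasurableB.
  by apply: vmeasurable_sum => j; apply: vmeasurableZ; exact: mx.
apply: vmeasurableZ; apply: vmeasurable_clip; apply: estimator_adapted.
by rewrite /= ltnS leqnn.
Qed.

Lemma state_adapted_le s t : (1 <= s <= t)%N -> (t <= T.+1)%N ->
  forall i, vmeasurable (T := hist t) (x i s).
Proof.
move=> /andP[s1 st] tT i k; apply: gmeasurable_mono (history_mono st) _.
by apply: state_adapted; rewrite s1 (leq_trans st tT).
Qed.

Definition mean_grad t w := grad (total_cost f t) (mean_state (xs w) t).

Lemma mean_grad_adapted s t : (1 <= s <= t)%N -> (t <= T.+1)%N ->
  vmeasurable (T := hist t) (mean_grad s).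
Proof.
move=> /[dup] st /andP[s1 st'] tT k.
have sT : (1 <= s <= T.+1)%N by rewrite s1 (leq_trans st' tT).
apply: (measurable_lipschitz (T := hist t) (L := M)
   (phi := fun y => grad (total_cost f s) y 0 k)).
  move=> y z; apply: le_trans (total_cost_lipschitz smooth y z sT).
  have := coord_le_enorm (grad (total_cost f s) y - grad (total_cost f s) z) k.
  by rewrite mxE [(- _ : 'M[R]_(_, _)) _ _]mxE; apply: le_trans; exact: ler_norm.
apply: vmeasurableZ; apply: vmeasurable_sum => i; exact: state_adapted_le.
Qed.

Lemma local_grad_adapted i s t : (1 <= s <= t)%N -> (t <= T.+1)%N ->
  vmeasurable (T := hist t) (fun w => grad (f i s) (x i s w)).
Proof.
move=> /[dup] st /andP[s1 st'] tT k.
have sT : (1 <= s <= T.+1)%N by rewrite s1 (leq_trans st' tT).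
apply: (measurable_lipschitz (T := hist t) (L := `|L|)
   (phi := fun y => grad (f i s) y 0 k)).
  move=> y z; apply: le_trans (cost_lipschitz smooth i y z sT).
  have := coord_le_enorm (grad (f i s) y - grad (f i s) z) k.
  by rewrite mxE [(- _ : 'M[R]_(_, _)) _ _]mxE; apply: le_trans; exact: ler_norm.
exact: state_adapted_le.
Qed.

Definition round_dev t w := step_dev (step t) (lam t) M (mean_grad t w)
  (fun i => grad (f i t) (x i t w)) (fun i => est i t w).
Definition round_drift t w := drift_term p a b f (xs w) t.

Lemma round_drift_ge0 t w : 0 <= round_drift t w.
Proof.
apply: mulr_ge0; last exact: sqr_ge0.
by apply: divr_ge0; [exact: step_size_ge0|exact: mulr_ge0].
Qed.

Lemma round_drift_adapted s t : (1 <= s <= t)%N -> (t <= T.+1)%N ->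
  measurable_fun setT (round_drift s : hist t -> R).
Proof.
move=> st tT; apply: measurable_funM => //; apply: measurable_funX.
by apply: measurable_enorm; exact: mean_grad_adapted.
Qed.

Lemma round_dev_adapted s t : (1 <= s < t)%N -> (t <= T.+1)%N ->
  measurable_fun setT (round_dev s : hist t -> R).
Proof.
move=> /[dup] st /andP[s1 st'] tT; have st2 : (1 <= s <= t)%N by rewrite s1 ltnW.
apply: (measurable_step_dev (Om := hist t)).
- exact: mean_grad_adapted.
- by move=> i; exact: local_grad_adapted.
- by move=> i; exact: estimator_adapted.
Qed.

Definition exp_process n w :=
  expR (\sum_(1 <= t < n.+1) (round_dev t w - round_drift t w)).

Lemma exp_process_ge0 n w : 0 <= exp_process n w.
Proof. exact: expR_ge0. Qed.

Lemma exp_process_adapted n : (n <= T)%N ->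
  measurable_fun setT (exp_process n : hist n.+1 -> R).
Proof.
move=> nT; apply: measurableT_comp => //.
have E : (fun w => \sum_(1 <= t < n.+1) (round_dev t w - round_drift t w)) =
    (fun w => \sum_(t < n) (round_dev t.+1 w - round_drift t.+1 w)).
  by apply/funext => w; rewrite big_add1 big_mkord.
rewrite [X in measurable_fun _ X]E; apply: measurable_sum => t.
apply: measurable_funB.
  by apply: round_dev_adapted => //=; rewrite ltnS.
by apply: round_drift_adapted => //=; rewrite ltnW// ltnS.
Qed.

(** The first summand is what Young's inequality leaves of the bias after [round_drift] has absorbed
    the rest; the second is the conditional bound on the squared clipped error. *)
Definition round_bound t : R := N%:R / 2 * (sigma `^ p) ^+ 2 *
    (step t * ((2 / lam t) `^ (p - 1)) ^+ 2) +
  sigma `^ p * step_exp_coef H M C1 * (4 `^ p * 2 `^ (2 - p)) *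
    (step t ^+ 2 * lam t `^ (2 - p)).

Let H0 : 0 <= H. Proof. by rewrite mulr_ge0// ltW. Qed.
Let M0 : 0 <= M. Proof. by rewrite mulr_ge0. Qed.

Definition bounded_at w := forall i t, (1 <= t <= T.+1)%N ->
  [/\ enorm (x i t w) <= BX, enorm (grad (f i t) (x i t w)) <= Bg &
      enorm (grad (f i t) (mean_state (xs w) t)) <= Bg].

Lemma local_grad_small w i t : bounded_at w -> (1 <= t <= T)%N ->
  2 * enorm (grad (f i t) (x i t w)) <= lam t.
Proof.
move=> bw /andP[t1 tT]; have [|_ + _] := bw i t; first by rewrite t1 leqW.
have := clip_level_ge p12 Bg0 t1; lra.
Qed.

Lemma round_dev_le w t : bounded_at w -> (1 <= t <= T)%N ->
  round_dev t w <= step_dev_max H M C1.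
Proof.
move=> bw /[dup] tT /andP[t1 tT']; apply: le_trans (ler_norm _) _.
apply: step_dev_abs => //.
- exact: step_size_ge0.
- exact: clip_level_gt0.
- exact: step_clip_le1.
- by apply: (mean_grad_bounded smooth bw); rewrite t1 leqW.
- by move=> i; exact: local_grad_small.
Qed.

(** A crude bound growing with [n]; it serves integrability and does not enter the final
    constant. *)
Lemma exp_process_ae_le n : (n <= T)%N ->
  {ae P, forall w, exp_process n w <= expR (n%:R * step_dev_max H M C1)}.
Proof.
move=> nT; apply: filterS bounded => w bw; rewrite ler_expR big_add1 big_mkord/=.
rewrite -sum_ord_const; apply: ler_sum => s _.
rewrite lerBlDr (le_trans (round_dev_le bw _))// ?lerDl ?round_drift_ge0//.
exact: leq_trans (ltn_ord s) nT.
Qed.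

Lemma exp_process_measurable n : (n <= T)%N ->
  measurable_fun setT (exp_process n).
Proof.
by move=> nT; apply: gmeasurable_measurable (history_measurable _) _ (exp_process_adapted nT).
Qed.

Lemma exp_process_integrable n : (n <= T)%N ->
  P.-integrable setT (EFin \o exp_process n).
Proof.
move=> nT; apply: (@ae_bounded_integrable _ _ _ _ _
  (expR (n%:R * step_dev_max H M C1)) (exp_process_measurable nT)).
apply: filterS (exp_process_ae_le nT) => w.
by rewrite (ger0_norm (exp_process_ge0 n w)).
Qed.

Lemma exp_process_step n : (n < T)%N ->
  \int[P]_w exp_process n.+1 w <= expR (round_bound n.+1) * \int[P]_w exp_process n w.
Proof.
move=> nT; set t := n.+1.
have tT : (1 <= t <= T)%N by [].
have tT' : (1 <= t <= T.+1)%N by rewrite /= leqW.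
have t0 : (0 < t)%N by [].
have tt : (1 <= t <= t)%N by rewrite leqnn.
have t_le : (t <= T.+1)%N by exact: leqW.
have lam0 : 0 < lam t by exact: clip_level_gt0.
have step0 : 0 <= step t by exact: step_size_ge0.
have N0' : 0 < N%:R :> R by rewrite ltr0n.
have G_sub := history_measurable (andP tT').2.
pose bcoef w := moment_coef N (step t) (lam t) H M C1 p (mean_grad t w).
have bcoef0 w : 0 <= bcoef w by exact: moment_coef_ge0.
have mean_le : {ae P, forall w, enorm (mean_grad t w) <= H}.
  by apply: filterS bounded => w bw; exact: (mean_grad_bounded smooth bw).
have /choice[Z hZ] i : exists Z : Om -> R, is_cond_exp P (history g x t)
      (fun w => enorm (est i t w - grad (f i t) (x i t w)) `^ p) Z /\
    {ae P, forall w, Z w <= sigma `^ p}.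
  by have [_ [Z h1 h2]] := noise i tT; exists Z.
have -> : \int[P]_w exp_process n.+1 w =
    \int[P]_w (exp_process n w * expR (round_dev t w - round_drift t w)).
  by apply: eq_Rintegral => w _; rewrite /exp_process -expRD big_nat_recr.
have bound_n := exp_process_ae_le (ltnW nT).
apply: (@exp_supermartingale_step _ _ _ P _ G_sub 'I_N ('I_N * 'I_d)%type
  (exp_process n) (round_dev t) (round_drift t) bcoef
  (fun j w => - (step t / N%:R) * mean_grad t w 0 j.2)
  (fun j w => est j.1 t w 0 j.2) (fun j w => grad (f j.1 t) (x j.1 t w) 0 j.2)
  (fun i w => enorm (est i t w - grad (f i t) (x i t w)) `^ p) Z
  (expR (n%:R * step_dev_max H M C1)) (step_dev_max H M C1) (step t / N%:R * H)
  (step t / N%:R * H * (2 / lam t) `^ (p - 1) + step_exp_coef H M C1 *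
     (step t ^+ 2 / N%:R) * (4 `^ p * 2 `^ (2 - p) * lam t `^ (2 - p)))
  (sigma `^ p) (round_bound t)) => //.
- by apply: exp_process_adapted; exact: ltnW.
- by move=> w; exact: expR_ge0.
- apply: gmeasurable_measurable (history_measurable (leqnn T.+1)) _ _.
  by apply: round_dev_adapted.
- by apply: filterS bounded => w bw; exact: round_dev_le.
- exact: round_drift_adapted tt t_le.
- by move=> w; exact: round_drift_ge0.
- apply: measurable_funD => //; apply: measurable_funM => //.
  apply: measurable_funM => //; apply: measurable_enorm.
  exact: mean_grad_adapted tt t_le.
- apply: filterS mean_le => w hw; rewrite /bcoef /moment_coef lerD2r.
  by rewrite ler_wpM2r ?powR_ge0// ler_wpM2l// divr_ge0.
- by move=> j; apply: measurable_funM => //; exact: mean_grad_adapted tt t_le _.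
- move=> j; apply: filterS mean_le => w hw.
  rewrite normrM normrN (ger0_norm (divr_ge0 step0 (ler0n R N))).
  rewrite ler_wpM2l//; first exact: (divr_ge0 step0 (ler0n R N)).
  exact: (le_trans (coord_le_enorm _ _) hw).
- by move=> j; have [_] := unbiased j.1 tT; apply.
- by move=> i; have [] := hZ i.
- by move=> i; have [] := hZ i.
- apply: filterS2 bounded mean_le => w bw hw.
  apply: expR_step_dev => //.
    exact: step_clip_le1.
  by move=> i; exact: local_grad_small.
- apply: aeW => w; rewrite card_ord /bcoef /moment_coef /round_bound.
  rewrite /round_drift /drift_term -/(mean_grad t w).
  set u := enorm _; set B' := (2 / lam t) `^ _; set s := sigma `^ p.
  set Q := step_exp_coef _ _ _; set K := 4 `^ p * _; set l := lam t `^ _.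
  have N_neq0 : N%:R != 0 :> R by rewrite gt_eqF.
  have -> : N%:R * s * (step t / N%:R * u * B' +
      Q * (step t ^+ 2 / N%:R) * (K * l)) =
      step t * u * (B' * s) + s * Q * K * (step t ^+ 2 * l) by field.
  (* Young's inequality as a completed square: its u^2 term is exactly the drift of the round. *)
  have : 0 <= step t / (2 * N%:R) * (u - N%:R * (B' * s)) ^+ 2.
    by rewrite mulr_ge0 ?sqr_ge0// divr_ge0// mulr_ge0.
  have -> : step t / (2 * N%:R) * (u - N%:R * (B' * s)) ^+ 2 =
      step t / (2 * N%:R) * u ^+ 2 - step t * u * (B' * s) +
      N%:R / 2 * s ^+ 2 * (step t * B' ^+ 2) by field.
  lra.
Qed.

Lemma exp_process_bound n : (n <= T)%N ->
  \int[P]_w exp_process n w <= expR (\sum_(1 <= t < n.+1) round_bound t).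
Proof.
elim: n => [_|n IH nT].
  have -> : exp_process 0 = cst 1.
    by apply/funext => w; rewrite /exp_process big_geq// expR0.
  rewrite big_geq// expR0; have := Rintegral_cst P measurableT 1.
  rewrite mul1r => ->.
  have /eqP : fine (P [set: Om]) = 1 by rewrite probability_setT.
  by rewrite eq_le => /andP[].
apply: le_trans (exp_process_step nT) _.
apply: le_trans (ler_wpM2l (expR_ge0 _) (IH (ltnW nT))) _.
have -> : \sum_(1 <= t < n.+2) round_bound t =
    round_bound n.+1 + \sum_(1 <= t < n.+1) round_bound t.
  by rewrite big_nat_recr//= addrC.
by rewrite expRD.
Qed.

(** Markov's inequality at the level exp(Cv) / delta. *)
Lemma exp_process_tail (delta Cv : R) : 0 < delta ->
  (\sum_(1 <= t < T.+1) round_bound t <= Cv) ->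
  (P [set w | (expR Cv / delta <= exp_process T w)%R] <= delta%:E)%E.
Proof.
move=> delta0 hCv; have iT := exp_process_integrable (leqnn T).
have c0 : 0 < expR Cv / delta by rewrite divr_gt0 ?expR_gt0.
have := le_integral_abse P measurableT (measurable_int _ iT) c0.
rewrite setTI.
have -> : [set w | ((expR Cv / delta)%:E <= `|(EFin \o exp_process T) w|)%E] =
    [set w | expR Cv / delta <= exp_process T w].
  by apply/seteqP; split => w /=; rewrite lee_fin ger0_norm ?exp_process_ge0.
have -> : (\int[P]_w `|(EFin \o exp_process T) w| =
    (\int[P]_w exp_process T w)%R%:E)%E.
  rewrite /Rintegral fineK; last exact: (integrable_fin_num measurableT iT).
  by apply: eq_integral => w _; rewrite /= ger0_norm ?exp_process_ge0.
have hb := le_trans (exp_process_bound (leqnn T)) (etrans (ler_expR _ _) hCv).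
move=> /le_trans /(_ (_ : (_ <= (expR Cv)%:E)%E)); rewrite lee_fin => /(_ hb).
rewrite -lee_pdivlMl// => /le_trans; apply.
rewrite -EFinM lee_fin invf_div divfK//.
by rewrite gt_eqF ?expR_gt0.
Qed.

Lemma nreg_measurable : measurable_fun setT (fun w => nreg f (xs w) T).
Proof.
have -> : (fun w => nreg f (xs w) T) = (fun w => \sum_(t < T)
    \sum_(i < N) enorm (grad (total_cost f t.+1) (x i t.+1 w)) ^+ 2).
  by apply/funext => w; rewrite /nreg big_add1 big_mkord.
apply: measurable_sum => t; apply: measurable_sum => i.
have tT : (1 <= t.+1 <= T.+1)%N by rewrite /= ltnW// ltnS.
apply: measurable_funX; apply: measurable_enorm => k.
apply: (measurable_lipschitz (L := M) (phi := fun y => grad (total_cost f t.+1) y 0 k)).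
  move=> y z; apply: le_trans (total_cost_lipschitz smooth y z tT).
  have := coord_le_enorm (grad (total_cost f t.+1) y - grad (total_cost f t.+1) z) k.
  by rewrite mxE [(- _ : 'M[R]_(_, _)) _ _]mxE; apply: le_trans; exact: ler_norm.
move=> j; apply: gmeasurable_measurable (history_measurable (andP tT).2) _ _.
exact: state_adapted.
Qed.

(** The bad event is covered by the null set where the iterates are unbounded and by the tail event
    of the exponential process. *)
Lemma nreg_probability (delta Cv r : R) : 0 < delta ->
  (\sum_(1 <= t < T.+1) round_bound t <= Cv) ->
  (forall w, bounded_at w -> exp_process T w < expR Cv / delta ->
     nreg f (xs w) T <= r) ->
  ((1 - delta)%:E <= P [set w | (nreg f (xs w) T <= r)%R])%E.
Proof.
move=> delta0 hCv good; set A := [set w | _].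
have mA : measurable A.
  have := nreg_measurable measurableT (measurable_itv `]-oo, r]).
  rewrite setTI; congr measurable.
have [Nl [mN PN subN]] := bounded.
set D := [set w | expR Cv / delta <= exp_process T w].
have mD : measurable D.
  have := exp_process_measurable (leqnn T) measurableT
    (measurable_itv `[expR Cv / delta, +oo[).
  rewrite setTI; congr measurable.
  by apply/seteqP; split => w /=; rewrite in_itv/= andbT.
have subA : ~` A `<=` Nl `|` D.
  move=> w nAw; have [bw|nbw] := pselect (bounded_at w); last by left; exact: subN.
  by right; rewrite /D/= leNgt; apply/negP => /(good _ bw).
have PA : (P (~` A) <= delta%:E)%E.
  apply: le_trans (le_measure P _ _ subA) _; rewrite ?inE//.
  - exact: measurableC.
  - exact: measurableU.
  apply: le_trans (measureU2 _ mN mD) _.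
  have PN0 : (P Nl <= 0)%E by have -> : P Nl = 0%E by exact: PN.
  by rewrite -[delta%:E]add0e; apply: leeD => //; exact: exp_process_tail.
rewrite -[A]setCK probability_setC; last exact: measurableC.
by rewrite EFinB leeB.
Qed.

End Supermartingale.

(** * Conclusion *)

Section FunctionVariation.
Variables (R : realType) (d N : nat) (f : 'I_N -> nat -> 'rV[R]_d -> R) (T : nat).

Let jump t : \bar R := ereal_sup
  [set (`|total_cost f t y - total_cost f t.-1 y|)%:E | y in [set: 'rV[R]_d]].

Let jump_ge t y : ((`|total_cost f t y - total_cost f t.-1 y|)%:E <= jump t)%E.
Proof. by apply: ereal_sup_ubound; exists y. Qed.

Let jump_ge0 t : (0 <= jump t)%E.
Proof. by apply: le_trans (jump_ge t 0); rewrite lee_fin. Qed.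

Lemma function_variation_ge0 : (0 <= function_variation f T)%E.
Proof. by apply: sume_ge0 => t _; exact: jump_ge0. Qed.

Lemma function_variation_finite : function_variation f T \is a fin_num ->
  exists2 dl : nat -> R,
    forall t y, (2 <= t <= T)%N ->
      `|total_cost f t y - total_cost f t.-1 y| <= dl t &
    function_variation f T = (\sum_(2 <= t < T.+1) dl t)%:E.
Proof.
move=> fin.
have jump_fin t : (2 <= t <= T)%N -> jump t \is a fin_num.
  move=> /andP[t2 tT]; rewrite ge0_fin_numE ?jump_ge0//.
  apply: le_lt_trans (_ : (function_variation f T < +oo)%E); last first.
    by rewrite -ge0_fin_numE ?function_variation_ge0.
  rewrite /function_variation (bigD1_seq t) ?iota_uniq//=; last first.
    by rewrite mem_index_iota t2 ltnS.
  by rewrite leeDl// sume_ge0// => s _; exact: jump_ge0.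
exists (fun t => fine (jump t)).
  by move=> t y tT; rewrite -lee_fin fineK ?jump_fin.
rewrite -sumEFin /function_variation big_nat [RHS]big_nat.
by apply: eq_bigr => t tT; rewrite fineK// jump_fin.
Qed.

End FunctionVariation.

Theorem corollary2 (R : realType) (d N : nat) (sigma p L BX Bg eta : R)
    (B : nat) (a b : R)
    (hN : (0 < N)%N) (hsigma : 0 < sigma) (hp : 1 < p <= 2)
    (hBX : 0 < BX) (hBg : 0 < Bg) (heta : 0 < eta < 1) (hB : (0 < B)%N)
    (ha : 0 < a) (hb : 0 <= b) :
  let kappa := (p + 1) / (2 * p) in
  let alpha := 1 / (2 * p) in
  let lam := fun t : nat => 2 * Bg * t%:R `^ alpha in
  let step := fun t : nat => 1 / (a * t%:R + b) `^ kappa in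
  exists2 K : R, 0 < K &
    forall (T : nat) (delta : R), (1 <= T)%N -> 0 < delta < 1 ->
    forall (dsp : measure_display) (Omega : measurableType dsp)
      (P : probability Omega R)
      (f : 'I_N -> nat -> 'rV[R]_d -> R)
      (W : nat -> 'M[R]_N) (E : nat -> rel 'I_N)
      (g : 'I_N -> nat -> 'rV[R]_d -> Omega -> 'rV[R]_d)
      (x1 : 'I_N -> 'rV[R]_d)
      (x : 'I_N -> nat -> Omega -> 'rV[R]_d),
    unbiased_gradients P T f g x ->
    heavy_tailed_noise P T p sigma f g x ->
    smooth_costs L T f ->
    bounded_iterates P T BX Bg f x ->
    network_assumption eta B W E ->
    odcsgd T lam step W x1 g x ->
    ((1 - delta)%:E <=
      P [set w | ((nreg f (fun i t => x i t w) T)%:E <=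
          K%:E * (T%:R `^ ((1 + p) / (2 * p)))%:E *
          (1 + function_variation f T + (ln (1 / delta))%:E))%E])%E.
Proof.
move=> kappa alpha lam step.
have [Cs Cs0 hCs] := step_sqr_sum hp ha hb.
have [Cc Cc0 hCc] := step_step_clip_sum hp hBg ha hb.
have [Cb Cb0 hCb] := step_bias_sum hp hBg ha hb.
have [Cr Cr0 hCr] := step_variance_sum hp hBg ha hb.
pose M := N%:R * `|L|; pose H := N%:R * Bg; pose C1 := rate_const p a * (2 * Bg).
pose q := step_exp_coef H M C1.
pose Cv := N%:R / 2 * (sigma `^ p) ^+ 2 * Cb +
  sigma `^ p * q * (4 `^ p * 2 `^ (2 - p)) * Cr.
pose Co := spread_total d N p BX eta B a b Cc.
pose c0 := 4 * N%:R ^+ 2 * ((H + 2 * M * BX) * (2 * BX) + M * (2 * BX) ^+ 2 + Cv +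
  H * `|L| * Co + 2 * M * Bg ^+ 2 * Cs) + 4 * N%:R * M ^+ 2 * BX * Co.
have N0 : 0 < N%:R :> R by rewrite ltr0n.
have M0 : 0 <= M by rewrite mulr_ge0.
have H0 : 0 <= H by rewrite mulr_ge0// ltW.
have q0 : 0 <= q by exact: step_exp_coef_ge0.
have bias0 : 0 <= N%:R / 2 * (sigma `^ p) ^+ 2.
  by apply: mulr_ge0; [rewrite divr_ge0|exact: sqr_ge0].
have var0 : 0 <= sigma `^ p * q * (4 `^ p * 2 `^ (2 - p)).
  by apply: mulr_ge0; apply: mulr_ge0 => //; exact: powR_ge0.
have Cv0 : 0 <= Cv by apply: addr_ge0; apply: mulr_ge0.
have Co0 : 0 <= Co.
  have [eta0 _] := andP heta; have BX0 := ltW hBX.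
  apply: mulr_ge0 => //; apply: mulr_ge0.
    by rewrite invr_ge0 exprn_ge0// ltW.
  apply: addr_ge0; last by rewrite !mulr_ge0.
  apply: mulr_ge0 => //.
  by apply: mulr_ge0; [exact: step_size_ge0|rewrite mulr_ge0].
have c00 : 0 <= c0.
  have BX0 := ltW hBX; have N2 : 0 <= 4 * N%:R ^+ 2 :> R by rewrite mulr_ge0 ?sqr_ge0.
  have MB : 0 <= 2 * M * BX by rewrite !mulr_ge0.
  have hL : 0 <= H * `|L| * Co by apply: mulr_ge0 => //; rewrite mulr_ge0.
  have hC : 0 <= 2 * M * Bg ^+ 2 * Cs.
    by apply: mulr_ge0 => //; apply: mulr_ge0; [rewrite mulr_ge0|exact: sqr_ge0].
  have h2 : 0 <= 4 * N%:R * M ^+ 2 * BX * Co.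
    apply: mulr_ge0 => //; apply: mulr_ge0 => //.
    by apply: mulr_ge0; [rewrite mulr_ge0|exact: sqr_ge0].
  have h3 : 0 <= (H + 2 * M * BX) * (2 * BX).
    by apply: mulr_ge0; [rewrite addr_ge0|rewrite mulr_ge0].
  have h4 : 0 <= M * (2 * BX) ^+ 2 by apply: mulr_ge0 => //; exact: sqr_ge0.
  apply: addr_ge0 h2; apply: mulr_ge0 N2 _.
  by do 4 apply: addr_ge0 => //.
have ab0 : 0 < (a + b) `^ kappa by rewrite powR_gt0// ltr_wpDr.
(* The variation enters [weighted_regret_bound] with coefficient 4 N^2 times 2, and [c0] collects
   the constant terms; (a + b)^kappa comes from inverting the last step size. *)
exists ((8 * N%:R ^+ 2 + c0) * (a + b) `^ kappa).
  by rewrite mulr_gt0// ltr_wpDr// mulr_gt0// exprn_gt0.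
move=> T delta T1 /andP[delta0 delta1] dsp Omega P f W E g x1 x
  unbiased noise smooth bounded network algo.
set K := _ * (a + b) `^ kappa.
have K0 : 0 < K by rewrite mulr_gt0// ltr_wpDr// mulr_gt0// exprn_gt0.
(* If the variation is infinite, the right-hand side is infinite because its factor is positive, and
   the event is the whole space. *)
have [fin|ninf] := boolP (function_variation f T \is a fin_num); last first.
  have -> : function_variation f T = +oo%E.
    apply/eqP; rewrite -leye_eq leNgt; apply: contra ninf.
    by rewrite ge0_fin_numE// function_variation_ge0.
  have T0 : 0 < T%:R `^ ((1 + p) / (2 * p)) :> R by rewrite powR_gt0// ltr0n.
  rewrite addey// addye// -EFinM gt0_muley; last by rewrite lte_fin; exact: mulr_gt0 K0 T0.
  have -> : [set w | ((nreg f (fun i t => x i t w) T)%:E <= +oo)%E] = setT.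
    by apply/seteqP; split => w //= _; rewrite leey.
  by rewrite probability_setT lee_fin gerBl ltW.
have [dl hdl fvE] := function_variation_finite fin.
set D := \sum_(2 <= t < T.+1) dl t in fvE.
have D0 : 0 <= D by rewrite -lee_fin -fvE function_variation_ge0.
pose l := ln (1 / delta).
have l0 : 0 <= l by rewrite ln_ge0// div1r invf_ge1// ltW.
pose r := K * T%:R `^ ((1 + p) / (2 * p)) * (1 + D + l).
have -> : [set w | ((nreg f (fun i t => x i t w) T)%:E <=
    K%:E * (T%:R `^ ((1 + p) / (2 * p)))%:E *
    (1 + function_variation f T + (ln (1 / delta))%:E))%E] =
    [set w | (nreg f (fun i t => x i t w) T <= r)%R].
  by apply/seteqP; split => w /=; rewrite fvE -!EFinD -!EFinM lee_fin.
have hCv : \sum_(1 <= t < T.+1) round_bound N sigma p L Bg a b t <= Cv.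
  rewrite big_split/= -!mulr_sumr; apply: lerD.
    exact: (ler_wpM2l bias0 (hCb T)).
  exact: (ler_wpM2l var0 (hCr T)).
apply: (nreg_probability hN hp hBg ha hb unbiased noise smooth bounded algo delta0 hCv).
move=> w bw expT.
(* Taking logarithms off the tail event: this is where log(1/delta) appears. *)
have hZ : \sum_(1 <= t < T.+1) (round_dev p L Bg a b f g x t w -
    round_drift p a b f x t w) <= Cv + l.
  rewrite -ler_expR expRD /l lnK ?posrE ?divr_gt0// mulrA mulr1.
  exact: ltW.
have upd i t : (1 <= t <= T)%N -> x i t.+1 w = \sum_(j < N) W t i j *: x j t w -
    step_size p a b t *: clip (clip_level p Bg t) (g i t (x i t w) w).
  by case: algo => _; apply.
have := weighted_regret_bound hN hp hBX hBg heta ha hb smooth network bw upd hdl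
  T1 hCs hCc hZ.
rewrite -/D -/M -/H -/Co => hreg.
have stepT : 0 < step_size p a b T by exact: step_size_gt0.
have step_inv := step_size_inv_le hp ha hb T1.
apply: le_trans (_ : (step_size p a b T)^-1 *
    ((8 * N%:R ^+ 2 + c0) * (1 + D + l)) <= _).
  rewrite ler_pdivlMl//; apply: le_trans hreg _.
  have N2 : 0 <= N%:R ^+ 2 :> R by exact: sqr_ge0.
  have := mulr_ge0 N2 l0; have := mulr_ge0 c00 (addr_ge0 D0 l0).
  rewrite /c0; lra.
rewrite /r /K.
have -> : (8 * N%:R ^+ 2 + c0) * (a + b) `^ kappa * T%:R `^ ((1 + p) / (2 * p)) *
    (1 + D + l) = ((a + b) `^ kappa * T%:R `^ ((1 + p) / (2 * p))) *
    ((8 * N%:R ^+ 2 + c0) * (1 + D + l)) by ring.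
rewrite ler_wpM2r//.
  apply: mulr_ge0; apply: addr_ge0 => //; last exact: addr_ge0.
by rewrite [1 + p]addrC.
Qed.
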